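(* Let $L>0$, let $I,J\subset\mathbb R$ be intervals with $0\in J$, and let $X:I\times J\to\mathrm{AdS}_3(L)$ be a local nondegenerate cohomogeneity-one immersion with induced metric $g=\sigma\,ds^2+\eta\,\rho(s)^2dt^2$, where $\sigma,\eta\in\{-1,+1\}$ and $\rho>0$, with unit normal $\xi$, $\varepsilon=\langle\xi,\xi\rangle=-\sigma\eta$, and shape operator satisfying $Ae_1=k_1(s)e_1$, $Ae_2=k_2(s)e_2$ for $e_1=\partial_s$, $e_2=\rho^{-1}\partial_t$. Put $q=\rho'/\rho$, and assume that the Gauss-Codazzi equations $$q'=\sigma\Bigl(\frac1{L^2}-\varepsilon k_1k_2\Bigr)-q^2,\qquad k_2'=q(k_1-k_2)$$ hold. Then $$\mathfrak c=\eta\rho^2\Bigl(\frac1{L^2}-\sigma q^2-\varepsilon k_2^2\Bigr)$$ is constant. Moreover, there exists a constant element $\mathcal B\in\mathfrak{so}(2,2)$ such that $$X_t=\mathcal BX,\qquad X(s,t)=e^{t\mathcal B}X(s,0).$$ The generator satisfies $\mathcal B^3=\mathfrak c\,\mathcal B$. The generator has rank two, and its rank-two causal normal-form type is: $$\begin{aligned}\mathfrak c<0&\iff\text{elliptic rotation on a definite two-plane},\\ \mathfrak c>0&\iff\text{hyperbolic boost on a Lorentzian two-plane},\\ \mathfrak c=0&\iff\text{index-three parabolic null rotation}.\end{aligned}$$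
   Context: $\mathbb R^{2,2}$ is $\mathbb R^4$ with $\langle X,X\rangle=-X_0^2-X_1^2+X_2^2+X_3^2$; $\mathrm{AdS}_3(L)=\{X\in\mathbb R^{2,2}:\langle X,X\rangle=-L^2\}$ with the induced Lorentzian metric (constant curvature $-1/L^2$); $\mathfrak{so}(2,2)$ is the Lie algebra of endomorphisms of $\mathbb R^{2,2}$ skew-adjoint for $\langle\cdot,\cdot\rangle$. The shape operator is defined by $\nabla^N_Y\xi=-AY$ with $\nabla^N$ the Levi-Civita connection of $\mathrm{AdS}_3(L)$. Primes denote $d/ds$. The ambient frame is $\mathcal F=(E_0,e_1,e_2,\xi)$ with $E_0=X/L$ (and $e_1,e_2$ identified with their images), with Gram matrix $\operatorname{diag}(-1,\sigma,\eta,\varepsilon)$. It satisfies $\mathcal F_t=\mathcal FM$, $\mathcal F_s=\mathcal FN$ with $$M=\rho\begin{pmatrix}0&0&\eta/L&0\\0&0&-\sigma\eta q&0\\1/L&q&0&-k_2\\0&0&\varepsilon\eta k_2&0\end{pmatrix},\qquad N=\begin{pmatrix}0&\sigma/L&0&0\\1/L&0&0&-k_1\\0&0&0&0\\0&\varepsilon\sigma k_1&0&0\end{pmatrix}.$$ Types of a rank-two $B\in\mathfrak{so}(2,2)$. Elliptic rotation on a definite two-plane: $W=\operatorname{im}B$ is a definite plane, $\ker B=W^\perp$, and $B|_W$ is, after scaling, an infinitesimal rotation ($B^2=\chi\,\mathrm{id}$ on $W$ with $\chi<0$). Hyperbolic boost on a Lorentzian two-plane: $W=\operatorname{im}B$ has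 signature $(1,1)$, $\ker B=W^\perp$, and $B|_W$ is, after scaling, an infinitesimal boost ($B^2=\chi\,\mathrm{id}$ on $W$ with $\chi>0$). Index-three parabolic null rotation: $B^3=0$ and $B^2\neq0$. *)

(* Defs.v *)
From HB Require Import structures.
From mathcomp Require Export all_boot all_order all_algebra.
From mathcomp Require Export all_classical all_reals all_analysis.
Export Order.TTheory GRing.Theory Num.Theory numFieldNormedType.Exports.

Set Implicit Arguments.
Unset Strict Implicit.
Unset Printing Implicit Defensive.

Local Open Scope classical_set_scope.
Local Open Scope ring_scope.

(* Derivatives relative to a set D, so that arbitrary intervals, possibly
   containing endpoints, are allowed as domains. If D is a neighbourhood of x
   this is the ordinary derivative; at an endpoint it is the one-sided one. *)
Section RelativeDerivative.
Variables (R : realType) (V : normedModType R).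

Definition quot_in (f : R -> V) (x : R) : R -> V :=
  fun y => (y - x)^-1 *: (f y - f x).

Definition derivable_in (D : set R) (f : R -> V) (x : R) : Prop :=
  cvg (quot_in f x @ within D (dnbhs x)).

Definition deriv_in (D : set R) (f : R -> V) (x : R) : V :=
  lim (quot_in f x @ within D (dnbhs x)).

Fixpoint Ck_in (D : set R) (k : nat) (f : R -> V) : Prop :=
  {within D, continuous f} /\
  if k is k'.+1 then
    (forall x, D x -> derivable_in D f x) /\ Ck_in D k' (deriv_in D f)
  else True.

Definition smooth_in (D : set R) (f : R -> V) : Prop := forall k, Ck_in D k f.

(* Partial derivatives of f : I x J -> V, (s, t) |-> f s t. *)
Definition partial_s (I : set R) (f : R -> R -> V) (s t : R) : V :=
  deriv_in I (fun s' => f s' t) s.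

Definition partial_t (J : set R) (f : R -> R -> V) (s t : R) : V :=
  deriv_in J (f s) t.

Fixpoint Ck_in2 (I J : set R) (k : nat) (f : R -> R -> V) : Prop :=
  {within I `*` J, continuous (fun p : R * R => f p.1 p.2)} /\
  if k is k'.+1 then
    [/\ forall s t, I s -> J t ->
          derivable_in I (fun s' => f s' t) s /\ derivable_in J (f s) t,
        Ck_in2 I J k' (partial_s I f) & Ck_in2 I J k' (partial_t J f)]
  else True.

Definition smooth_in2 (I J : set R) (f : R -> R -> V) : Prop :=
  forall k, Ck_in2 I J k f.

(* The differential of f at (s, t) on the tangent vector Y^0 d/ds + Y^1 d/dt. *)
Definition diff_in2 (I J : set R) (f : R -> R -> V) (s t : R)
    (Y : 'cV[R]_2) : V :=
  Y 0 0 *: partial_s I f s t + Y 1 0 *: partial_t J f s t.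

End RelativeDerivative.

Section R22.
Variable R : realType.

(* - X_0 Y_0 - X_1 Y_1 + X_2 Y_2 + X_3 Y_3 *)
Definition ip22 (X Y : 'cV[R]_4) : R :=
  \sum_(i < 4) (-1) ^+ (i < 2)%N * X i 0 * Y i 0.

Definition AdS3 (L : R) : set 'cV[R]_4 := [set X | ip22 X X = - L ^+ 2].

Definition so22 (B : 'M[R]_4) : Prop :=
  forall X Y, ip22 (B *m X) Y = - ip22 X (B *m Y).

Definition expmx (A : 'M[R]_4) : 'M[R]_4 :=
  lim (series (fun k => (k`!%:R)^-1 *: A ^+ k) @ \oo).

(* B acts on column vectors, unlike the row-vector convention of %MS. *)
Definition im_mx (B : 'M[R]_4) : {vspace 'cV[R]_4} :=
  limg (linfun (mulmx B : 'cV[R]_4 -> 'cV[R]_4)).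

Definition ker_mx (B : 'M[R]_4) : {vspace 'cV[R]_4} :=
  lker (linfun (mulmx B : 'cV[R]_4 -> 'cV[R]_4)).

Definition is_orthogonal_of (K W : {vspace 'cV[R]_4}) : Prop :=
  forall v, v \in K <-> (forall w, w \in W -> ip22 v w = 0).

Definition definite_plane (W : {vspace 'cV[R]_4}) : Prop :=
  (\dim W = 2)%N /\
  ((forall w, w \in W -> w != 0 -> 0 < ip22 w w) \/
   (forall w, w \in W -> w != 0 -> ip22 w w < 0)).

(* Signature (1,1), witnessed by a pseudo-orthonormal basis. *)
Definition lorentzian_plane (W : {vspace 'cV[R]_4}) : Prop :=
  exists u v, [/\ basis_of W [:: u; v],
                  ip22 u u = -1, ip22 v v = 1 & ip22 u v = 0].

Definition elliptic_rotation (B : 'M[R]_4) : Prop :=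
  [/\ definite_plane (im_mx B), is_orthogonal_of (ker_mx B) (im_mx B) &
      exists2 chi : R, chi < 0 &
        forall w, w \in im_mx B -> B *m (B *m w) = chi *: w].

Definition hyperbolic_boost (B : 'M[R]_4) : Prop :=
  [/\ lorentzian_plane (im_mx B), is_orthogonal_of (ker_mx B) (im_mx B) &
      exists2 chi : R, 0 < chi &
        forall w, w \in im_mx B -> B *m (B *m w) = chi *: w].

Definition parabolic_null_rotation (B : 'M[R]_4) : Prop :=
  B ^+ 3 = 0 /\ B ^+ 2 <> 0.

End R22.

Section SurfacesInAdS.
Variables (R : realType) (L : R) (I J : set R) (X : R -> R -> 'cV[R]_4).

Definition induced_metric (s t : R) (Y Z : 'cV[R]_2) : R :=
  ip22 (diff_in2 I J X s t Y) (diff_in2 I J X s t Z).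

Definition unit_normal_field (eps : R) (xi : R -> R -> 'cV[R]_4) : Prop :=
  forall s t, I s -> J t ->
    [/\ ip22 (xi s t) (X s t) = 0,
        forall Y, ip22 (xi s t) (diff_in2 I J X s t Y) = 0 &
        ip22 (xi s t) (xi s t) = eps].

(* The Levi-Civita connection of AdS_3(L), applied to a field V along X, is the
   flat derivative followed by the orthogonal projection of R^{2,2} onto
   T_X AdS_3(L) = X^perp, where <X, X> = - L^2. *)
Definition nablaN (V : R -> R -> 'cV[R]_4) (s t : R) (Y : 'cV[R]_2) :
    'cV[R]_4 :=
  let DV := diff_in2 I J V s t Y in
  DV + (ip22 DV (X s t) / L ^+ 2) *: X s t.

(* A s t is the matrix, in the frame (d/ds, d/dt), of the shape operator. *)
Definition shape_operator (xi : R -> R -> 'cV[R]_4) (A : R -> R -> 'M[R]_2) :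
    Prop :=
  forall s t, I s -> J t -> forall Y,
    nablaN xi s t Y = - diff_in2 I J X s t (A s t *m Y).

End SurfacesInAdS.

(* Main.v *)
From HB Require Import structures.
Require Import Defs.
From mathcomp Require Import ring lra.

Set Implicit Arguments.
Unset Strict Implicit.
Unset Printing Implicit Defensive.

Local Open Scope classical_set_scope.
Local Open Scope ring_scope.

(** The generator is a simple bivector. Put P = X_t and
    Z = - X / L^2 + sigma q X_s - eps k_2 xi. The matrix taking the frame to
    its t-derivative is, in ambient coordinates, the skew-adjoint map
      B v = <Z, v> P - <P, v> Z
    of the bivector P /\ Z. Since <P, X> = 0 and <Z, X> = 1, it sends X to X_t.

    B does not depend on (s, t). Differentiating the Gram matrix of the frame
    (X, X_s, X_t, xi), together with X_st = X_ts, gives the structure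
    equations [structure_equations]; with Gauss and Codazzi they read
      P_s = q P,  Z_s = - q Z,  P_t = - <P, P> Z,  Z_t = <Z, Z> P,
    and in both directions the two terms of the derivative of P /\ Z cancel
    ([generator_cst]). Hence X_t = B X with B constant, and X = e^(tB) X(s, 0)
    by uniqueness for linear equations, here through the Taylor remainder
    ([linear_ode_expmx]).

    The algebra of B is read off on the plane spanned by the orthogonal vectors
    P and Z: B P = - <P, P> Z and B Z = <Z, Z> P, so B^2 = c on this plane with
    c = - <P, P> <Z, Z> = eta rho^2 (1 / L^2 - sigma q^2 - eps k_2^2). As the
    plane is the image of B, this gives B^3 = c B and rank two, and since B is
    a nonzero constant, c is constant. P is never null, so the sign of c
    compares the signs of <P, P> and <Z, Z>: the plane is definite for c < 0,
    Lorentzian for c > 0, and for c = 0 it is degenerate with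
    B^2 X = - <P, P> Z nonzero ([wedge22_causal_type]).

    The domains may contain endpoints, so all derivatives are relative to the
    domain and the calculus is developed in that setting. On an interval it
    reduces to ordinary derivatives at interior points plus relative continuity
    at the endpoints, which is what the mean value theorem uses. *)

(** * Calculus of relative derivatives *)

Section HasDeriv.
Variables (R : realType).

(** The existence and the value of a derivative in a single statement, so that
    both pass together through the sum and product rules below. *)
Definition has_deriv_in (V : normedModType R) (D : set R) (f : R -> V) (x : R)
  (l : V) : Prop := quot_in f x @ within D (dnbhs x) --> l.

Implicit Types V : normedModType R.

Lemma derivable_inP V D (f : R -> V) x :
  derivable_in D f x -> has_deriv_in D f x (deriv_in D f x).
Proof. by []. Qed.

(** Every point of a nondegenerate interval, endpoints included, is a limit of
    other points of it: moving towards another point of the interval stays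
    inside by convexity. This is what makes relative derivatives unique. *)
Lemma interval_limit_point (D : set R) x :
  is_interval D -> D° !=set0 -> D x -> ProperFilter (within D (dnbhs x)).
Proof.
move=> iD [z Dz] Dx; apply: Build_ProperFilter_ex => A.
rewrite /within /dnbhs /within /= => /nbhs_ballP[e /= e0 He].
have {Dz} [y Dy yx] : exists2 y, D y & y != x.
  case: (eqVneq z x) Dz => [->|zx] Dz; last by exists z => //; exact: interior_subset.
  move: Dz => /nbhs_ballP[d /= d0 Hd]; exists (x + d / 2).
    by apply: Hd; rewrite /ball /= opprD addNKr normrN gtr0_norm; lra.
  by rewrite -subr_eq0 addrC addKr; lra.
have [k k0 [k1 ke]] : exists2 k : R, 0 < k & k <= 1 /\ k * `|y - x| < e.
  exists (Num.min 1 (e / 2 / `|y - x|)).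
    by rewrite lt_min ltr01 !divr_gt0 // normr_gt0 subr_eq0.
  split; first by rewrite ge_min lexx.
  have yx0 : 0 < `|y - x| by rewrite normr_gt0 subr_eq0.
  apply: (@le_lt_trans _ _ (e / 2 / `|y - x| * `|y - x|)); last first.
    by rewrite divfK ?gt_eqF //; lra.
  by rewrite ler_wpM2r ?ge_min ?lexx ?orbT.
exists (x + k * (y - x)); apply: He => /=.
- rewrite /ball /= opprD addNKr normrN normrM gtr0_norm //; lra.
- by rewrite -subr_eq0 addrC addKr mulf_neq0 // ?subr_eq0 // (gt_eqF k0).
- case: (lerP x y) => xy.
    apply: (iD x y) => //; nra.
  apply: (iD y x) => //; nra.
Qed.

Lemma has_deriv_inE V D (f : R -> V) x l : ProperFilter (within D (dnbhs x)) ->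
  has_deriv_in D f x l -> deriv_in D f x = l.
Proof. by move=> PF h; apply: cvg_lim => //; exact: norm_hausdorff. Qed.

Lemma has_deriv_in_unique V D (f : R -> V) x l l' :
  ProperFilter (within D (dnbhs x)) ->
  has_deriv_in D f x l -> has_deriv_in D f x l' -> l = l'.
Proof.
by move=> PF h h'; rewrite -(has_deriv_inE PF h) (has_deriv_inE PF h').
Qed.

Lemma eq_has_deriv_in V D (f g : R -> V) x l : D x ->
  (forall y, D y -> f y = g y) -> has_deriv_in D f x l -> has_deriv_in D g x l.
Proof.
move=> Dx fg; apply: cvg_trans; apply: fmap_within_eq => y /set_mem Dy.
by rewrite /quot_in !fg.
Qed.

Lemma has_deriv_in_cst V D (a : V) x : has_deriv_in D (fun=> a) x 0.
Proof.
rewrite /has_deriv_in (_ : quot_in _ _ = fun=> 0); first exact: cvg_cst.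
by apply/funext => y; rewrite /quot_in subrr scaler0.
Qed.

Lemma has_deriv_in_id D x : has_deriv_in D (id : R -> R) x 1.
Proof.
apply: (@cvg_trans _ (cst (1:R) @ within D (dnbhs x))); last exact: cvg_cst.
apply: near_eq_cvg; rewrite near_withinE; near=> y => _.
apply/esym/mulVf; rewrite subr_eq0.
by near: y; exact: nbhs_dnbhs_neq.
Unshelve. all: by end_near. Qed.

Lemma has_deriv_inD V D (f g : R -> V) x l m :
  has_deriv_in D f x l -> has_deriv_in D g x m ->
  has_deriv_in D (fun y => f y + g y) x (l + m).
Proof.
move=> hf hg; rewrite /has_deriv_in.
rewrite (_ : quot_in _ _ = quot_in f x \+ quot_in g x); first exact: cvgD.
by apply/funext => y; rewrite /quot_in /= -scalerDr opprD addrACA.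
Qed.

Lemma has_deriv_in_continuous V D (f : R -> V) x l :
  has_deriv_in D f x l -> f @ within D (nbhs x) --> f x.
Proof.
move=> h.
suff H : f @ within D (dnbhs x) --> f x.
  move=> A fA; have Afx := nbhs_singleton fA.
  have {}H : nbhs x (fun y => y != x -> D y -> A (f y)) := H A fA.
  suff : nbhs x (fun y => D y -> A (f y)) by [].
  apply: filterS H => y hy Dy; have [->//|yx] := eqVneq y x; exact: hy.
have -> : f x = f x + (x - x) *: l by rewrite subrr scale0r addr0.
apply: (@cvg_trans _ ((fun y => f x + (y - x) *: quot_in f x y)
    @ within D (dnbhs x))).
  apply: near_eq_cvg; rewrite near_withinE; near=> y => _.
  rewrite /quot_in scalerA mulfV ?scale1r ?subrKC // subr_eq0.
  by near: y; exact: nbhs_dnbhs_neq.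
apply: cvgD; first exact: cvg_cst.
apply: cvgZ => //; apply: cvgB; last exact: cvg_cst.
by apply: cvg_within_filter; exact: nbhs_dnbhs.
Unshelve. all: by end_near. Qed.

Lemma has_deriv_inZ V D (f : R -> R) (g : R -> V) x l m :
  has_deriv_in D f x l -> has_deriv_in D g x m ->
  has_deriv_in D (fun y => f y *: g y) x (l *: g x + f x *: m).
Proof.
move=> hf hg; rewrite /has_deriv_in.
rewrite (_ : quot_in _ _ = (fun y => quot_in f x y *: g y + f x *: quot_in g x y)).
  apply: cvgD; last by apply: cvgZ => //; exact: cvg_cst.
  apply: cvgZ => //; have := has_deriv_in_continuous hg; apply: cvg_trans.
  by apply: cvg_fmap2 => A; rewrite /within /=; exact: nbhs_dnbhs.
apply/funext => y; rewrite /quot_in /=.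
have -> : (y - x)^-1 *: (f y - f x) = (y - x)^-1 * (f y - f x) by [].
rewrite -scalerA (scalerA (f x)) [f x * _]mulrC -scalerA -scalerDr.
by congr (_ *: _); rewrite scalerBl scalerBr subrKA.
Qed.

Lemma has_deriv_inM D (f g : R -> R) x l m :
  has_deriv_in D f x l -> has_deriv_in D g x m ->
  has_deriv_in D (fun y => f y * g y) x (l * g x + f x * m).
Proof. exact: has_deriv_inZ. Qed.

Lemma has_deriv_in_scale V D (a : R) (g : R -> V) x m :
  has_deriv_in D g x m -> has_deriv_in D (fun y => a *: g y) x (a *: m).
Proof.
move=> hg; have := has_deriv_inZ (has_deriv_in_cst D a x) hg.
by rewrite scale0r add0r.
Qed.

Lemma has_deriv_in_sum V D n (f : 'I_n -> R -> V) x (l : 'I_n -> V) :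
  (forall i, has_deriv_in D (f i) x (l i)) ->
  has_deriv_in D (fun y => \sum_i f i y) x (\sum_i l i).
Proof.
elim: n f l => [|n IH] f l h.
  rewrite big_ord0 (_ : (fun=> _) = fun=> 0); first exact: has_deriv_in_cst.
  by apply/funext => y; rewrite big_ord0.
rewrite big_ord_recl; rewrite (_ : (fun=> _) =
    fun y => f ord0 y + \sum_(i < n) f (lift ord0 i) y).
  by apply: has_deriv_inD => //; apply: IH => i.
by apply/funext => y; rewrite big_ord_recl.
Qed.

(** The difference quotient of 1 / f is that of f times - 1 / (f(y) f(x)), and
    f(y) stays away from 0 near x by continuity. *)
Lemma has_deriv_inV D (f : R -> R) x l : f x != 0 ->
  has_deriv_in D f x l -> has_deriv_in D (fun y => (f y)^-1) x (- l / f x ^+ 2).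
Proof.
move=> fx0 hf; have cf := has_deriv_in_continuous hf.
have {}cf : f @ within D (dnbhs x) --> f x.
  apply: cvg_trans cf.
  by apply: cvg_fmap2 => A; rewrite /within /=; exact: nbhs_dnbhs.
apply: (@cvg_trans _ ((fun y => - quot_in f x y * ((f y)^-1 * (f x)^-1))
    @ within D (dnbhs x))); last first.
  rewrite expr2 invfM; apply: cvgM; first exact: cvgN.
  by apply: cvgM; [exact: cvgV|exact: cvg_cst].
apply: near_eq_cvg.
have : \forall y \near within D (dnbhs x), f y != 0.
  by apply: cvgr_neq0 cf fx0.
apply: filterS => y fy0; rewrite /quot_in /= /GRing.scale /=.
move: (y - x)^-1 => k; field.
by rewrite fx0 fy0.
Unshelve. all: by end_near. Qed.

Lemma has_deriv_in_entry D m n (f : R -> 'M[R]_(m.+1, n.+1)) x l i j :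
  has_deriv_in D f x l -> has_deriv_in D (fun y => f y i j) x (l i j).
Proof.
move=> hf; rewrite /has_deriv_in.
rewrite (_ : quot_in _ _ = (fun M : 'M[R]_(m.+1, n.+1) => M i j) \o quot_in f x).
  by apply: continuous_cvg => //; exact: coord_continuous.
by apply/funext => y; rewrite /quot_in /= !mxE.
Qed.

(** At interior points the relative derivative is the two-sided one; this is
    the bridge to the classical mean value theorems. *)
Lemma has_deriv_in_is_derive D (f : R -> R) x l : D° x ->
  has_deriv_in D f x l -> is_derive x 1 f l.
Proof.
move=> Dx hf.
suff H : (fun h : R => h^-1 *: (f (h *: (1 : R) + x) - f x)) @ dnbhs (0 : R) --> l.
  apply: DeriveDef; first by apply/cvg_ex; exists l.
  by apply: cvg_lim => //; exact: norm_hausdorff.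
move=> A Al.
have hA : nbhs x (fun y => y != x -> D y -> A (quot_in f x y)) := hf A Al.
have /nbhs_ballP[e /= e0 He] : nbhs x (fun y => y != x -> A (quot_in f x y)).
  by apply: filterS2 hA Dx => y h Dy yx; exact: h.
suff : nbhs (0 : R) (fun h => h != 0 -> A (h^-1 *: (f (h *: (1 : R) + x) - f x))).
  by [].
apply/nbhs_ballP; exists e => //= h; rewrite /ball /= sub0r normrN => he h0.
have -> : h *: (1 : R) + x = h + x by rewrite /GRing.scale /= mulr1.
have := He (h + x); rewrite /ball /= /quot_in addrK opprD addrCA subrr addr0 normrN.
by apply => //; rewrite -subr_eq0 addrK.
Qed.

Lemma sub_has_deriv_in V (D E : set R) (f : R -> V) x l : E `<=` D ->
  has_deriv_in D f x l -> has_deriv_in E f x l.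
Proof.
by move=> ED; apply: cvg_trans; apply: cvg_fmap2; exact: within_subset.
Qed.

Section MeanValue.
Variables (D : set R) (iD : is_interval D) (f f' : R -> R).
Hypothesis ff' : forall x, D x -> has_deriv_in D f x (f' x).

Lemma interval_interior a b x : D a -> D b -> a < x < b -> D° x.
Proof.
move=> Da Db xab.
have : nbhs x `]a, b[%classic by exact: near_in_itvoo.
apply: filterS => y /=; rewrite in_itv /= => /andP[ay yb].
by apply: (iD Da Db); rewrite !ltW.
Qed.

Lemma has_deriv_in_within_continuous : {within D, continuous f}.
Proof.
by apply/subspace_continuousP => x Dx; exact: has_deriv_in_continuous (ff' Dx).
Qed.

Lemma subitv_continuous a b : D a -> D b -> {within `[a, b], continuous f}.
Proof.
move=> Da Db; apply: continuous_subspaceW has_deriv_in_within_continuous.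
by move=> x; rewrite /= in_itv /= => xab; exact: (iD Da Db).
Qed.

Lemma subitv_is_derive a b x : D a -> D b -> x \in `]a, b[%R -> is_derive x 1 f (f' x).
Proof.
move=> Da Db; rewrite in_itv /= => xab.
have Dx := interval_interior Da Db xab.
exact: has_deriv_in_is_derive (ff' (interior_subset Dx)).
Qed.

(** The endpoints are unordered and may coincide, and the location of the
    intermediate point is recorded as a distance to [a]; this is the form that
    the second-difference argument iterates. *)
Lemma has_deriv_in_MVT a b : D a -> D b ->
  exists c, [/\ D c, `|c - a| <= `|b - a| & f b - f a = f' c * (b - a)].
Proof.
move=> Da Db; case: (ltgtP a b) => [ab|ba|->]; last first.
- by exists b; rewrite !subrr mulr0.
- have [c] := MVT ba (fun x => @subitv_is_derive _ _ x Db Da) (subitv_continuous Db Da).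
  rewrite in_itv /= => /andP[bc ca] E; exists c; split.
  + by apply: (iD Db Da); rewrite !ltW.
  + by rewrite !ltr0_norm; lra.
  + by rewrite -(opprB a b) mulrN -E opprB.
- have [c] := MVT ab (fun x => @subitv_is_derive _ _ x Da Db) (subitv_continuous Da Db).
  rewrite in_itv /= => /andP[ac cb] E; exists c; split => //.
  + by apply: (iD Da Db); rewrite !ltW.
  + by rewrite !gtr0_norm; lra.
Qed.

End MeanValue.

Lemma has_deriv_inX D n x : has_deriv_in D (fun y : R => y ^+ n) x (n%:R * x ^+ n.-1).
Proof.
elim: n => [|n IH].
  rewrite mul0r (_ : (fun=> _) = fun=> 1); first exact: has_deriv_in_cst.
  by apply/funext => y; rewrite expr0.
have := has_deriv_inM (has_deriv_in_id D x) IH.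
rewrite (_ : (fun=> _) = fun y : R => y ^+ n.+1); last first.
  by apply/funext => y; rewrite exprS.
rewrite (_ : 1 * _ + _ = n.+1%:R * x ^+ n.+1.-1) //.
case: n {IH} => [|n] /=; first by rewrite expr0; ring.
by rewrite exprS -(natr1 n.+1); ring.
Qed.

(** Integration of a power bound without integrals: Cauchy's mean value theorem
    compares f with x^(n+1) on the segment between 0 and x, where the derivative
    of x^(n+1) vanishes only at 0. *)
Lemma has_deriv_in_power_bound D (f f' : R -> R) n K : is_interval D -> D 0 ->
  (forall x, D x -> has_deriv_in D f x (f' x)) -> f 0 = 0 ->
  (forall x, D x -> `|f' x| <= K * `|x| ^+ n) ->
  forall x, D x -> `|f x| <= K * `|x| ^+ n.+1 / n.+1%:R.
Proof.
move=> iD D0 ff' f0 bf' x Dx.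
have gg' y (Dy : D y) := @has_deriv_inX D n.+1 y.
have [->|x0] := eqVneq x 0; first by rewrite f0 !normr0 exprS mul0r mulr0 mul0r.
have n0 : n.+1%:R != 0 :> R by rewrite pnatr_eq0.
have [c [Dc c0 E]] : exists c, [/\ D c, c != 0 &
    f x * (n.+1%:R * c ^+ n) = f' c * x ^+ n.+1].
  have key a b : a < b -> D a -> D b -> 0 \in [:: a; b] -> x \in [:: a; b] ->
      exists c, [/\ D c, c != 0 &
        (f b - f a) * (n.+1%:R * c ^+ n) = f' c * (b ^+ n.+1 - a ^+ n.+1)].
    move=> ab Da Db m0 mx.
    have nz y : y \in `]a, b[%R -> y != 0.
      rewrite in_itv /= => /andP[ay yb]; apply/eqP => y0.
      by move: m0; rewrite !inE => /orP[]/eqP; lra.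
    have dg0 y : y \in `]a, b[%R -> n.+1%:R * y ^+ n.+1.-1 != 0.
      by move=> yab; rewrite mulf_neq0 // expf_neq0 // nz.
    have Dg y (yab : y \in `]a, b[%R) := subitv_is_derive iD gg' Da Db yab.
    have Df y (yab : y \in `]a, b[%R) := subitv_is_derive iD ff' Da Db yab.
    have cf := subitv_continuous iD ff' Da Db.
    have cg := subitv_continuous iD gg' Da Db.
    have [c cab E] := cauchy_MVT ab cf cg Df Dg dg0.
    have G := differentiable_subr_neq0 ab cg Dg dg0.
    exists c; split; last 1 first.
    - by move/eqP: E; rewrite eqr_div ?dg0 // => /eqP /= ->; rewrite mulrC.
    - move: cab; rewrite in_itv /= => /andP[ac cb].
      by apply: (iD _ _ Da Db); rewrite !ltW.
    - exact: nz.
  case: (ltgtP x 0) => [xn|xp|xE]; last by rewrite xE eqxx in x0.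
  - have [c [Dc c0 E]] := key x 0 xn Dx D0 (mem_last x [:: 0]) (mem_head x [:: 0]).
    exists c; split => //; move: E; rewrite f0 expr0n /= !sub0r mulNr mulrN.
    by move/oppr_inj.
  - have [c [Dc c0 E]] := key 0 x xp D0 Dx (mem_head 0 [:: x]) (mem_last 0 [:: x]).
    by exists c; split => //; move: E; rewrite f0 expr0n /= !subr0.
have cn0 : 0 < `|c| ^+ n by rewrite exprn_gt0 // normr_gt0.
have np : 0 < n.+1%:R :> R by rewrite ltr0n.
rewrite ler_pdivlMr // -(ler_pM2r cn0) -mulrA.
have := congr1 (fun z : R => `|z|) E.
rewrite /= !normrM !normrX (gtr0_norm np) => ->.
rewrite mulrAC ler_wpM2r ?exprn_ge0 //; exact: bf'.
Qed.

Lemma deriv_in_eq0_cst D m (f : R -> 'cV[R]_m.+1) : is_interval D ->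
  (forall x, D x -> has_deriv_in D f x 0) ->
  forall x y, D x -> D y -> f x = f y.
Proof.
move=> iD h x y Dx Dy; apply/colP => i.
have h' z : D z -> has_deriv_in D (fun u => f u i 0) z 0.
  by move=> Dz; have := @has_deriv_in_entry D m 0 f z 0 i 0 (h z Dz); rewrite mxE.
have [c [_ _ ]] := has_deriv_in_MVT iD h' Dx Dy.
by rewrite mul0r => /eqP; rewrite subr_eq0 => /eqP.
Qed.

(** The mean value theorem applied first in s to u |-> f(u, t') - f(u, t), then
    in t to the s-derivative at the intermediate point. *)
Lemma second_difference (I J : set R) (f fs fs_t : R -> R -> R) s t s' t' :
  is_interval I -> is_interval J ->
  (forall s t, I s -> J t -> has_deriv_in I (f^~ t) s (fs s t)) ->
  (forall s t, I s -> J t -> has_deriv_in J (fs s) t (fs_t s t)) ->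
  I s -> J t -> I s' -> J t' ->
  exists c d, [/\ I c, J d, `|c - s| <= `|s' - s|, `|d - t| <= `|t' - t| &
    f s' t' - f s' t - (f s t' - f s t) = fs_t c d * (t' - t) * (s' - s)].
Proof.
move=> iI iJ f_s f_st Is Jt Is' Jt'.
have h u : I u -> has_deriv_in I (fun u => f u t' - f u t) u (fs u t' - fs u t).
  move=> Iu; rewrite -scaleN1r.
  rewrite (_ : (fun=> _) = fun u => f u t' + -1 *: f u t); last first.
    by apply/funext => v; rewrite scaleN1r.
  by apply: has_deriv_inD; [exact: f_s|apply: has_deriv_in_scale; exact: f_s].
have [c [Ic cs ->]] := has_deriv_in_MVT iI h Is Is'.
have [d [Jd dt ->]] := has_deriv_in_MVT iJ (fun v Jv => f_st c v Ic Jv) Jt Jt'.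
by exists c, d.
Qed.

Lemma within_continuous2P (I J : set R) (g : R -> R -> R) s t e :
  {within I `*` J, continuous (fun p : R * R => g p.1 p.2)} ->
  I s -> J t -> 0 < e ->
  exists2 d : R, 0 < d & forall u v, I u -> J v -> `|u - s| < d -> `|v - t| < d ->
    `|g s t - g u v| < e.
Proof.
move=> /subspace_continuousP /(_ (s, t)) H Is Jt e0.
have {H} := H (conj Is Jt).
move/cvgrPdist_lt => /(_ e e0).
rewrite near_withinE => /nbhs_ballP[d /= d0 Hd]; exists d => // u v Iu Jv us vt.
by apply: (Hd (u, v)) => //; split; rewrite /ball /= distrC.
Qed.

(** Symmetry of mixed second derivatives, also at boundary points of I x J. The
    second difference over a small rectangle with one corner at (s, t) is the
    area times a value of either mixed derivative near (s, t). Both orders give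
    the same number, so by continuity the two derivatives agree at (s, t). *)
Lemma schwarz_in (I J : set R) (f fs ft fs_t ft_s : R -> R -> R) :
  is_interval I -> I° !=set0 -> is_interval J -> J° !=set0 ->
  (forall s t, I s -> J t -> has_deriv_in I (f^~ t) s (fs s t)) ->
  (forall s t, I s -> J t -> has_deriv_in J (f s) t (ft s t)) ->
  (forall s t, I s -> J t -> has_deriv_in J (fs s) t (fs_t s t)) ->
  (forall s t, I s -> J t -> has_deriv_in I (ft^~ t) s (ft_s s t)) ->
  {within I `*` J, continuous (fun p : R * R => fs_t p.1 p.2)} ->
  {within I `*` J, continuous (fun p : R * R => ft_s p.1 p.2)} ->
  forall s t, I s -> J t -> fs_t s t = ft_s s t.
Proof.
move=> iI I0 iJ J0 f_s f_t f_st f_ts cont_st cont_ts s t Is Jt.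
apply/eqP; rewrite -subr_eq0 -normr_eq0; apply/negPn/negP => /negP ne0.
set e := `|_ - _| in ne0.
have e0 : 0 < e / 2 by rewrite divr_gt0 // lt_def normr_ge0 andbT; apply/negP.
have [d1 d10 h1] := within_continuous2P cont_st Is Jt e0.
have [d2 d20 h2] := within_continuous2P cont_ts Is Jt e0.
pose d := Num.min d1 d2.
have d0 : 0 < d by rewrite lt_min d10.
have close (D : set R) x : is_interval D -> D° !=set0 -> D x ->
    exists y, [/\ D y, y != x & `|y - x| < d].
  move=> iD D0 Dx; have PF := interval_limit_point iD D0 Dx.
  have : within D (dnbhs x) (fun y => [/\ D y, y != x & `|y - x| < d]).
    apply/nbhs_ballP; exists d => //= y; rewrite /ball /= distrC.
    by split.
  exact: filter_ex.
have [s' [Is' ss' sd]] := close I s iI I0 Is.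
have [t' [Jt' tt' td]] := close J t iJ J0 Jt.
have [a [b [Ia Jb as_ bt E1]]] := second_difference iI iJ f_s f_st Is Jt Is' Jt'.
have [b' [a' [Jb' Ia' bt' as' E2]]] := @second_difference J I
  (fun t s => f s t) (fun t s => ft s t) (fun t s => ft_s s t) t s t' s' iJ iI
  (fun t s Jt Is => f_t s t Is Jt) (fun t s Jt Is => f_ts s t Is Jt)
  Jt Is Jt' Is'.
have E : fs_t a b = ft_s a' b'.
  apply: (@mulIf _ ((t' - t) * (s' - s))); first by rewrite mulf_neq0 ?subr_eq0.
  rewrite mulrA -E1 [(t' - t) * _]mulrC mulrA -E2; ring.
have H1 := h1 a b Ia Jb. have H2 := h2 a' b' Ia' Jb'.
have {}H1 : `|fs_t s t - fs_t a b| < e / 2.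
  by apply: H1; [apply: le_lt_trans as_ _|apply: le_lt_trans bt _];
    apply: lt_le_trans; [exact: sd| |exact: td|]; rewrite ge_min lexx.
have {}H2 : `|ft_s s t - ft_s a' b'| < e / 2.
  by apply: H2; [apply: le_lt_trans as' _|apply: le_lt_trans bt' _];
    apply: lt_le_trans; [exact: sd| |exact: td|]; rewrite ge_min lexx orbT.
have : e < e / 2 + e / 2.
  apply: le_lt_trans (ltrD H1 H2).
  rewrite /e E -[X in _ <= _ + X]normrN; apply: le_trans (ler_normD _ _).
  by rewrite opprB addrA subrK.
lra.
Qed.

End HasDeriv.

(** * The matrix exponential and linear differential equations *)

(* The completeness of matrix spaces is what turns absolute convergence of the
   exponential series into convergence. *)
HB.instance Definition _ (R : realType) (m n : nat) :=
  Complete.on 'M[R]_(m.+1, n.+1).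

Section Exponential.
Variable R : realType.

Lemma mx_entry_le_norm m n (M : 'M[R]_(m, n)) i j : `|M i j| <= `|M|.
Proof.
rewrite [leRHS]/Num.Def.normr /= mx_normrE.
exact: (@le_bigmax _ _ _ 0 (fun ij => `|M ij.1 ij.2|) (i, j)).
Qed.

Lemma mx_norm_le m n (M : 'M[R]_(m, n)) a : 0 <= a ->
  (forall i j, `|M i j| <= a) -> `|M| <= a.
Proof.
move=> a0 h; rewrite [leLHS]/Num.Def.normr /= mx_normrE.
by apply: bigmax_le => // -[i j] _; exact: h.
Qed.

(** The matrix norm is the largest entry, which is submultiplicative only up to
    the inner dimension; hence the factors 4 in the estimates below. *)
Lemma mulmx_entry_le m n p (M : 'M[R]_(m, n)) (N : 'M[R]_(n, p)) a i k :
  (forall j, `|N j k| <= a) -> `|(M *m N) i k| <= n%:R * `|M| * a.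
Proof.
move=> h; rewrite mxE; apply: (le_trans (ler_norm_sum _ _ _)).
rewrite -mulrA -[n in n%:R]card_ord mulr_natl -sumr_const.
apply: ler_sum => j _; rewrite normrM ler_pM //; exact: mx_entry_le_norm.
Qed.

Lemma is_cvg_expmx (M : 'M[R]_4) :
  cvgn (series (fun k => (k`!%:R)^-1 *: M ^+ k)).
Proof.
apply: normed_cvg.
apply: series_le_cvg (is_cvg_series_exp_coeff (4 * `|M|)) => n //=.
  by rewrite /exp_coeff divr_ge0 ?exprn_ge0 ?mulr_ge0.
rewrite /exp_coeff /= normrZ mulrC normfV ger0_norm // ler_pM2r; last first.
  by rewrite invr_gt0 ltr0n fact_gt0.
elim: n => [|n IH].
  apply: mx_norm_le => // i j; rewrite !expr0 mxE.
  by case: eqP; rewrite ?normr1 ?normr0.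
apply: mx_norm_le => [|i j]; first by rewrite exprn_ge0 ?mulr_ge0.
rewrite !exprS; apply: mulmx_entry_le => k.
exact: le_trans (mx_entry_le_norm _ _ _) IH.
Qed.

Lemma has_deriv_in_exp_monomial D k (w : 'cV[R]_4) x :
  has_deriv_in D (fun y : R => (k.+1`!%:R^-1 * y ^+ k.+1) *: w) x
    ((k`!%:R^-1 * x ^+ k) *: w).
Proof.
have h := has_deriv_inZ (has_deriv_in_scale (a := k.+1`!%:R^-1)
  (@has_deriv_inX R D k.+1 x)) (has_deriv_in_cst D w x).
move: h; rewrite scaler0 addr0 /= /GRing.scale /=.
have -> // : (k.+1)`!%:R^-1 * (k.+1%:R * x ^+ k) = k`!%:R^-1 * x ^+ k.
by rewrite factS natrM invfM mulrACA mulVf ?mul1r ?pnatr_eq0.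
Qed.

Definition exp_partial (M : 'M[R]_4) (w : 'cV[R]_4) n (x : R) : 'cV[R]_4 :=
  \sum_(k < n) (k`!%:R^-1 * x ^+ k) *: (M ^+ k *m w).

Lemma has_deriv_in_exp_partial D M w n x :
  has_deriv_in D (exp_partial M w n.+1) x (M *m exp_partial M w n x).
Proof.
have h := has_deriv_inD (has_deriv_in_cst D w x)
  (has_deriv_in_sum (fun k : 'I_n => @has_deriv_in_exp_monomial D k (M ^+ k.+1 *m w) x)).
rewrite add0r in h.
have -> : exp_partial M w n.+1 =
    fun y => w + \sum_(k < n) (k.+1`!%:R^-1 * y ^+ k.+1) *: (M ^+ k.+1 *m w).
  apply/funext => y; rewrite /exp_partial big_ord_recl /= !expr0 invr1 mulr1.
  by rewrite scale1r mul1mx.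
have -> // : M *m exp_partial M w n x =
  \sum_(k < n) (k`!%:R^-1 * x ^+ k) *: (M ^+ k.+1 *m w).
rewrite /exp_partial mulmx_sumr.
by apply: eq_bigr => k _; rewrite -scalemxAr mulmxA exprS.
Qed.

(** Differentiating the remainder of order n + 1 gives M times the remainder of
    order n, so each step integrates the previous power bound; the bounds are
    C times the terms of the exponential series of 4 |M| |x|. *)
Lemma has_deriv_in_linear_ode_remainder D (M : 'M[R]_4) (y : R -> 'cV[R]_4) C :
  is_interval D -> D 0 -> (forall x, D x -> has_deriv_in D y x (M *m y x)) ->
  (forall x, D x -> `|y x| <= C) ->
  forall n x, D x -> forall i,
    `|(y x - exp_partial M (y 0) n x) i 0| <= C * exp_coeff (4 * `|M| * `|x|) n.
Proof.
move=> iD D0 yM yC; elim=> [|n IH] x Dx i.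
  rewrite /exp_partial big_ord0 subr0 /exp_coeff /= expr0 invr1 !mulr1.
  exact: le_trans (mx_entry_le_norm _ _ _) (yC _ Dx).
have h z : D z -> has_deriv_in D
    (fun z => (y z - exp_partial M (y 0) n.+1 z) i 0) z
    ((M *m (y z - exp_partial M (y 0) n z)) i 0).
  move=> Dz; apply: (@has_deriv_in_entry _ _ 3 0
    (fun z => y z - exp_partial M (y 0) n.+1 z)).
  rewrite mulmxBr -scaleN1r.
  rewrite (_ : (fun=> _) = fun z => y z + -1 *: exp_partial M (y 0) n.+1 z).
    apply: has_deriv_inD; first exact: yM.
    by apply: has_deriv_in_scale; exact: has_deriv_in_exp_partial.
  by apply/funext => u; rewrite scaleN1r.
pose K := 4 * `|M| * (C * (4 * `|M|) ^+ n / n`!%:R).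
have bound z : D z ->
    `|(M *m (y z - exp_partial M (y 0) n z)) i 0| <= K * `|z| ^+ n.
  move=> Dz; apply: le_trans (mulmx_entry_le M i (fun j => IH z Dz j)) _.
  by rewrite /K /exp_coeff /= exprMn; lra.
have z0 : (y 0 - exp_partial M (y 0) n.+1 0) i 0 = 0.
  rewrite /exp_partial big_ord_recl /= expr0 invr1 mulr1 scale1r mul1mx.
  rewrite big1 ?addr0 ?subrr ?mxE // => k _.
  by rewrite exprS mul0r mulr0 scale0r.
apply: le_trans (has_deriv_in_power_bound iD D0 h z0 bound Dx) _.
rewrite /K /exp_coeff /= factS natrM invfM [(_ * _) ^+ n.+1]exprMn !exprS.
by move: n.+1%:R^-1 n`!%:R^-1 => u v; lra.
Qed.

(** On the compact segment between 0 and x the solution is bounded, so the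
    remainder bound tends to 0 and the exponential series applied to y(0)
    converges to y(x). This gives uniqueness without differentiating the
    exponential. *)
Lemma linear_ode_expmx J (M : 'M[R]_4) (y : R -> 'cV[R]_4) :
  is_interval J -> J 0 -> (forall x, J x -> has_deriv_in J y x (M *m y x)) ->
  forall x, J x -> y x = expmx (x *: M) *m y 0.
Proof.
move=> iJ J0 yM x Jx.
pose a := Num.min 0 x; pose b := Num.max 0 x.
have ab : a <= b by rewrite /a /b ge_min le_max lexx.
pose D := [set z | a <= z <= b].
have DJ : D `<=` J.
  move=> z /andP[az zb]; move: az zb; rewrite /a /b; case: (lerP 0 x) => ? ? ?.
    by apply: (iJ 0 x) => //; apply/andP.
  by apply: (iJ x 0) => //; apply/andP.
have iD : is_interval D.
  move=> u v /andP[au ub] /andP[av vb] z /andP[uz zv]; apply/andP; split.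
    exact: le_trans uz.
  exact: le_trans vb.
have D0 : D 0 by rewrite /D /= /a /b ge_min le_max !lexx ?orbT.
have Dx : D x by rewrite /D /= /a /b ge_min le_max !lexx ?orbT.
have yD z : D z -> has_deriv_in D y z (M *m y z).
  by move=> Dz; exact: (sub_has_deriv_in DJ (yM z (DJ z Dz))).
have [C yC] : exists C, forall z, D z -> `|y z| <= C.
  have [|c _ hc] := @EVT_max R (fun z => `|y z|) a b ab.
    apply/subspace_continuousP => z; rewrite /= in_itv => Dz.
    apply: cvg_trans (cvg_norm (has_deriv_in_continuous (yD z Dz))).
    by apply: cvg_fmap2; apply: within_subset => u; rewrite /= in_itv.
  by exists `|y c| => z Dz; apply: hc; rewrite in_itv.
have bound := has_deriv_in_linear_ode_remainder iD D0 yD yC.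
apply/colP => i.
have lim1 : (fun n => exp_partial M (y 0) n x i 0) @ \oo --> y x i 0.
  apply/cvgrPdist_le => e e0.
  have : (fun n => C * exp_coeff (4 * `|M| * `|x|) n) @ \oo --> C * 0.
    by apply: cvgM; [exact: cvg_cst|exact: cvg_exp_coeff].
  rewrite mulr0 => /cvgrPdist_le /(_ e e0).
  apply: filterS => n; rewrite sub0r normrN => /(le_trans (ler_norm _)).
  by apply: le_trans; have := bound n x Dx i; rewrite !mxE.
have lim2 : (fun n => exp_partial M (y 0) n x i 0) @ \oo -->
    (expmx (x *: M) *m y 0) i 0.
  have -> : (fun n => exp_partial M (y 0) n x i 0) = fun n => \sum_j
      (series (fun k => (k`!%:R)^-1 *: (x *: M) ^+ k) n) i j * y 0 j 0.
    apply/funext => n.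
    rewrite /exp_partial /series /= big_mkord.
    have -> : \sum_(k < n) (k`!%:R^-1 * x ^+ k) *: (M ^+ k *m y 0) =
        (\sum_(k < n) k`!%:R^-1 *: (x *: M) ^+ k) *m y 0.
      rewrite mulmx_suml; apply: eq_bigr => k _.
      by rewrite exprZn scalerA scalemxAl.
    by rewrite mxE.
  rewrite mxE; apply: cvg_big => [|j _]; first exact: add_continuous.
   apply: cvgM; last exact: cvg_cst.
  have H : series (fun k => k`!%:R^-1 *: (x *: M) ^+ k) @ \oo --> expmx (x *: M).
    exact: is_cvg_expmx.
  exact: (cvg_comp _ _ H (@coord_continuous R 4 4 i j (expmx (x *: M)))).
by apply: cvg_unique lim1 lim2; exact: norm_hausdorff.
Qed.

End Exponential.

(** * Bivectors in the neutral space *)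

Section NeutralForm.
Variable R : realType.
Implicit Types (u v w P Z X : 'cV[R]_4) (a b : R).

Lemma ip22E u v :
  ip22 u v =
    - (u 0 0 * v 0 0) - u 1 0 * v 1 0 + u 2%:R 0 * v 2%:R 0 + u 3%:R 0 * v 3%:R 0.
Proof.
rewrite /ip22 !big_ord_recl big_ord0 /= !expr1 !expr0 !mulN1r !mul1r !mulNr addr0.
rewrite !addrA; congr (- (u _ _ * v _ _) - u _ _ * v _ _ + u _ _ * v _ _ + u _ _ * v _ _);
  exact: val_inj.
Qed.

Lemma ip22C u v : ip22 u v = ip22 v u.
Proof. by rewrite !ip22E; ring. Qed.

Lemma ip22Dl u v w : ip22 (u + v) w = ip22 u w + ip22 v w.
Proof. by rewrite !ip22E !mxE; ring. Qed.

Lemma ip22Zl a u w : ip22 (a *: u) w = a * ip22 u w.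
Proof. by rewrite !ip22E !mxE; ring. Qed.

Lemma ip22Nl u w : ip22 (- u) w = - ip22 u w.
Proof. by rewrite -scaleN1r ip22Zl mulN1r. Qed.

Lemma ip22Dr u v w : ip22 w (u + v) = ip22 w u + ip22 w v.
Proof. by rewrite !(ip22C w) ip22Dl. Qed.

Lemma ip22Zr a u w : ip22 w (a *: u) = a * ip22 w u.
Proof. by rewrite !(ip22C w) ip22Zl. Qed.

Lemma ip22Nr u w : ip22 w (- u) = - ip22 w u.
Proof. by rewrite !(ip22C w) ip22Nl. Qed.

Lemma ip220l w : ip22 0 w = 0.
Proof. by rewrite -(scale0r 0) ip22Zl mul0r. Qed.

Definition ip22_lin := (ip22Dl, ip22Dr, ip22Nl, ip22Nr, ip22Zl, ip22Zr).

Definition flat22 v : 'rV[R]_4 := \row_j ((-1) ^+ (j < 2)%N * v j 0).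

Lemma flat22E v w : flat22 v *m w = (ip22 v w)%:M.
Proof.
apply/matrixP => i j; rewrite !ord1 !mxE eqxx mulr1n.
by apply: eq_bigr => k _; rewrite mxE.
Qed.

(** Four orthogonal non-null vectors form a basis: rescaled and lowered by the
    form they give a left inverse of the matrix with these columns, which is
    then a right inverse, so products with them determine a vector. *)
Lemma orthogonal_frame_ext (f : 'I_4 -> 'cV[R]_4) u v :
  (forall i j, i != j -> ip22 (f i) (f j) = 0) ->
  (forall i, ip22 (f i) (f i) != 0) ->
  (forall i, ip22 (f i) u = ip22 (f i) v) -> u = v.
Proof.
move=> orth nz uv.
pose A : 'M[R]_4 := \matrix_(i, j) ((ip22 (f i) (f i))^-1 * flat22 (f i) 0 j).
pose F : 'M[R]_4 := \matrix_(i, j) f j i 0.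
have Aw w : A *m w = \col_i ((ip22 (f i) (f i))^-1 * ip22 (f i) w).
  apply/colP => i; rewrite !mxE [ip22 (f i) w]/ip22 mulr_sumr.
  by apply: eq_bigr => k _; rewrite !mxE !mulrA.
have AF : A *m F = 1%:M.
  apply/matrixP => i j.
  have -> : (A *m F) i j = (A *m f j) i 0.
    by rewrite !mxE; apply: eq_bigr => k _; rewrite !mxE.
  rewrite Aw !mxE; have [->|ij] := eqVneq i j; first by rewrite mulVf.
  by rewrite (orth _ _ ij) mulr0.
rewrite -[u]mul1mx -[v]mul1mx -(mulmx1C AF) -!mulmxA; congr (_ *m _).
by rewrite !Aw; apply/colP => i; rewrite !mxE uv.
Qed.

Lemma eq_mulmx_col (A B : 'M[R]_4) : (forall v, A *m v = B *m v) -> A = B.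
Proof.
move=> AB; apply/matrixP => i j.
by have := congr1 (fun M : 'cV[R]_4 => M i 0) (AB (delta_mx j 0)); rewrite -!colE !mxE.
Qed.

Lemma mem_im_mx (B : 'M[R]_4) v : reflect (exists w, v = B *m w) (v \in im_mx B).
Proof.
apply: (iffP memv_imgP) => [[w _ ->]|[w ->]]; exists w; rewrite ?lfunE ?memvf //.
Qed.

Lemma mem_ker_mx (B : 'M[R]_4) v : (v \in ker_mx B) = (B *m v == 0).
Proof. by rewrite memv_ker lfunE. Qed.

(** The endomorphism of the bivector P /\ Z. The factorization through a space
    of dimension two is what the rank computation uses. *)
Definition wedge22 P Z : 'M[R]_4 :=
  row_mx P Z *m col_mx (flat22 Z) (- flat22 P).

Lemma wedge22E P Z v : wedge22 P Z *m v = ip22 Z v *: P - ip22 P v *: Z.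
Proof.
rewrite /wedge22 mul_row_col mulmxDl mulmxN mulNmx -!mulmxA !flat22E.
by rewrite !mul_mx_scalar.
Qed.

Lemma wedge22_so22 P Z : so22 (wedge22 P Z).
Proof. by move=> u v; rewrite !wedge22E !ip22_lin (ip22C u P) (ip22C u Z); ring. Qed.

Section RotationGenerator.
Variables (P Z X : 'cV[R]_4).
Hypotheses (PP : ip22 P P != 0) (PZ : ip22 P Z = 0).
Hypotheses (ZX : ip22 Z X = 1) (PX : ip22 P X = 0).
Let B := wedge22 P Z.
Let c := - (ip22 P P * ip22 Z Z).

Let BX : B *m X = P.
Proof. by rewrite wedge22E ZX PX scale1r scale0r subr0. Qed.

Let BP : B *m P = - ip22 P P *: Z.
Proof. by rewrite wedge22E ip22C PZ scale0r sub0r scaleNr. Qed.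

Let BZ : B *m Z = ip22 Z Z *: P.
Proof. by rewrite wedge22E PZ scale0r subr0. Qed.

Let P0 : P != 0.
Proof. by apply: contraNneq PP => ->; rewrite ip220l. Qed.

Let Z0 : Z != 0.
Proof. by apply/eqP => Z0; move: ZX; rewrite Z0 ip220l => /esym/eqP; rewrite oner_eq0. Qed.

Let comb_eq0 a b : a *: P + b *: Z = 0 -> a = 0 /\ b = 0.
Proof.
move=> E; have := congr1 (ip22 P) E; have := congr1 (ip22 X) E.
rewrite !ip22_lin PZ !(ip22C _ 0) !ip220l !(ip22C X) PX ZX !mulr0 mulr1 add0r addr0.
by move=> -> /eqP; rewrite mulf_eq0 (negPf PP) orbF => /eqP ->.
Qed.

(** B exchanges the lines of P and Z up to the factors - <P, P> and <Z, Z>, so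
    its square is their product on the whole plane. *)
Lemma wedge22_sqr v : v \in im_mx B -> B *m (B *m v) = c *: v.
Proof.
case/mem_im_mx => w ->; rewrite [B *m w]wedge22E mulmxBr -!scalemxAr BP BZ.
rewrite mulmxBr -!scalemxAr BP BZ !scalerA scalerBr !scalerA /c.
by congr (_ *: _ - _ *: _); ring.
Qed.

Lemma wedge22_cube : B ^+ 3 = c *: B.
Proof.
apply: eq_mulmx_col => v; rewrite -[B ^+ 3]/(B *m (B *m B)).
rewrite -(mulmxA B (B *m B)) -(mulmxA B B) -scalemxAl.
by apply: wedge22_sqr; apply/mem_im_mx; exists v.
Qed.

(** Both factors of the bivector have full rank. Their one-sided inverses are
    dual bases: X and P / <P, P> are dual to Z and P up to sign. X is needed
    because Z may be null. *)
Lemma mxrank_wedge22 : \rank B = 2%N.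
Proof.
rewrite /B /wedge22 mxrankMfree.
  apply/eqP; rewrite -[_ == _]/(row_full (row_mx P Z)); apply/row_fullP.
  exists (col_mx ((ip22 P P)^-1 *: flat22 P) (flat22 X)).
  rewrite mul_col_row -!scalemxAl !flat22E PZ (ip22C X) PX (ip22C X) ZX.
  by rewrite scale_scalar_mx mulVf // scale_scalar_mx mulr0 scalar_mx_block raddf0.
apply/row_freeP; exists (row_mx X (- (ip22 P P)^-1 *: P)).
rewrite mul_col_row -!scalemxAr !mulNmx !flat22E ZX (ip22C Z) PZ PX.
rewrite scale_scalar_mx mulr0 !raddf0 scalerN scaleNr opprK.
by rewrite scale_scalar_mx mulVf // scalar_mx_block.
Qed.

(** The scalars allow the generators to be normalized in the Lorentzian case. *)
Lemma im_wedge22_basis a b : a != 0 -> b != 0 ->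
  basis_of (im_mx B) [:: a *: P; b *: Z].
Proof.
move=> a0 b0; rewrite /basis_of eqEsubv; apply/andP; split; [apply/andP; split|].
- apply/span_subvP => v; rewrite !inE => /orP[]/eqP ->; apply/mem_im_mx.
    by exists (a *: X); rewrite -scalemxAr BX.
  exists ((- b / ip22 P P) *: P); rewrite -scalemxAr BP scalerA.
  by congr (_ *: _); field.
- apply/subvP => v /mem_im_mx[w ->]; rewrite wedge22E.
  rewrite span_cons span_seq1 memvB //.
    apply: (subvP (addvSl _ _)); apply/vlineP; exists (ip22 Z w / a).
    by rewrite scalerA divfK.
  apply: (subvP (addvSr _ _)); apply/vlineP; exists (ip22 P w / b).
  by rewrite scalerA divfK.
- rewrite free_cons seq1_free scaler_eq0 (negPf b0) (negPf Z0) andbT span_seq1.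
  apply/negP => /vlineP[k /eqP]; rewrite -subr_eq0 scalerA -scaleNr => /eqP.
  by case/comb_eq0 => /eqP; rewrite (negPf a0).
Qed.

Lemma mem_im_wedge22 v : v \in im_mx B -> exists a b, v = a *: P + b *: Z.
Proof.
case/mem_im_mx => w ->; exists (ip22 Z w), (- ip22 P w).
by rewrite wedge22E scaleNr.
Qed.

Lemma ker_wedge22_orthogonal : is_orthogonal_of (ker_mx B) (im_mx B).
Proof.
move=> v; rewrite mem_ker_mx wedge22E; split=> [/eqP E w|h].
  have := @comb_eq0 (ip22 Z v) (- ip22 P v).
  rewrite scaleNr => /(_ E)[Zv /eqP]; rewrite oppr_eq0 => /eqP Pv.
  move=> /mem_im_wedge22[a [b ->]].
  by rewrite !ip22_lin (ip22C v P) (ip22C v Z) Zv Pv !mulr0 addr0.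
have PB : P \in im_mx B by apply/mem_im_mx; exists X.
have ZB : Z \in im_mx B.
  apply/mem_im_mx; exists (- (ip22 P P)^-1 *: P).
  by rewrite -scalemxAr BP scalerA mulrNN mulVf ?scale1r.
by rewrite (ip22C Z) (ip22C P) !h // !scale0r subrr.
Qed.

(** c < 0 says that P and Z are non-null of the same causal character, and they
    are orthogonal. *)
Lemma wedge22_elliptic : c < 0 -> elliptic_rotation B.
Proof.
move=> c0; split; [|exact: ker_wedge22_orthogonal|by exists c => //; exact: wedge22_sqr].
have norm a b : ip22 (a *: P + b *: Z) (a *: P + b *: Z) =
    a ^+ 2 * ip22 P P + b ^+ 2 * ip22 Z Z.
  by rewrite !ip22_lin (ip22C Z P) PZ; ring.
have nz a b : a *: P + b *: Z != 0 -> 0 < a ^+ 2 \/ 0 < b ^+ 2.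
  move=> h; rewrite !exprn_even_gt0 //=; have [a0|] := eqVneq a 0; last by left.
  right; apply: contraNneq h => ->.
  by rewrite a0 !scale0r addr0.
split.
  have := im_wedge22_basis (oner_neq0 R) (oner_neq0 R).
  exact: (@size_basis _ _ _ _ [tuple 1 *: P; 1 *: Z]).
rewrite /c oppr_lt0 in c0.
have pos p z a b : 0 < p -> 0 < z -> 0 < a ^+ 2 \/ 0 < b ^+ 2 ->
    0 < a ^+ 2 * p + b ^+ 2 * z.
  move=> p0 z0; have A := mulr_ge0 (sqr_ge0 a) (ltW p0).
  have A' := mulr_ge0 (sqr_ge0 b) (ltW z0).
  by case=> h; [have := mulr_gt0 h p0|have := mulr_gt0 h z0]; lra.
have [Pp|] := ltrP 0 (ip22 P P).
  left=> w /mem_im_wedge22[a [b ->]] /nz; rewrite norm; apply: pos => //.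
  by rewrite pmulr_rgt0 in c0.
rewrite le_eqVlt (negPf PP) /= => Pn.
right=> w /mem_im_wedge22[a [b ->]] /nz; rewrite norm -oppr_gt0 opprD -!mulrN.
by apply: pos; rewrite oppr_gt0 //; rewrite nmulr_rgt0 in c0.
Qed.

(** c > 0 says that P and Z have opposite causal characters; normalized, they
    are the required basis, in the order given by which of them is timelike. *)
Lemma wedge22_hyperbolic : 0 < c -> hyperbolic_boost B.
Proof.
move=> c0; split; [|exact: ker_wedge22_orthogonal|by exists c => //; exact: wedge22_sqr].
have [Pneg|Ppos] := ltrP (ip22 P P) 0.
  have sp : 0 < Num.sqrt (- ip22 P P) by rewrite sqrtr_gt0; lra.
  have sz : 0 < Num.sqrt (ip22 Z Z) by rewrite sqrtr_gt0; rewrite /c in c0; nra.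
  have sp2 : Num.sqrt (- ip22 P P) ^+ 2 = - ip22 P P.
    by rewrite sqr_sqrtr //; rewrite sqrtr_gt0 in sp; exact: ltW.
  have sz2 : Num.sqrt (ip22 Z Z) ^+ 2 = ip22 Z Z.
    by rewrite sqr_sqrtr //; rewrite sqrtr_gt0 in sz; exact: ltW.
  move: (Num.sqrt (- ip22 P P)) (Num.sqrt (ip22 Z Z)) sp sz sp2 sz2 => x y x0 y0 x2 y2.
  exists (x^-1 *: P), (y^-1 *: Z); split.
  - by apply: im_wedge22_basis; rewrite invr_eq0 gt_eqF.
  - by rewrite !ip22_lin -[ip22 P P]opprK -x2; field; rewrite gt_eqF.
  - by rewrite !ip22_lin -y2; field; rewrite gt_eqF.
  - by rewrite !ip22_lin PZ !mulr0.
have {}Ppos : 0 < ip22 P P by rewrite lt_def PP.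
have sp : 0 < Num.sqrt (ip22 P P) by rewrite sqrtr_gt0.
have sz : 0 < Num.sqrt (- ip22 Z Z) by rewrite sqrtr_gt0; rewrite /c in c0; nra.
have sp2 : Num.sqrt (ip22 P P) ^+ 2 = ip22 P P.
  by rewrite sqr_sqrtr //; exact: ltW.
have sz2 : Num.sqrt (- ip22 Z Z) ^+ 2 = - ip22 Z Z.
  by rewrite sqr_sqrtr //; rewrite sqrtr_gt0 in sz; exact: ltW.
move: (Num.sqrt (ip22 P P)) (Num.sqrt (- ip22 Z Z)) sp sz sp2 sz2 => x y x0 y0 x2 y2.
exists (y^-1 *: Z), (x^-1 *: P); split.
- rewrite (@perm_basis _ _ _ [:: x^-1 *: P; y^-1 *: Z]).
    by apply: im_wedge22_basis; rewrite invr_eq0 gt_eqF.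
  by rewrite (perm_catC [:: _] [:: _]).
- by rewrite !ip22_lin -[ip22 Z Z]opprK -y2; field; rewrite gt_eqF.
- by rewrite !ip22_lin -x2; field; rewrite gt_eqF.
- by rewrite !ip22_lin ip22C PZ !mulr0.
Qed.

Lemma wedge22_parabolic : c = 0 -> parabolic_null_rotation B.
Proof.
move=> c0; split; first by rewrite wedge22_cube c0 scale0r.
move=> B2; have : B *m (B *m X) = 0.
  by rewrite (mulmxA B B) -[B *m B]/(B ^+ 2) B2 mul0mx.
by move/eqP; rewrite BX BP scaler_eq0 oppr_eq0 (negPf PP) (negPf Z0).
Qed.

Lemma wedge22_eigenvalue chi :
  (forall w, w \in im_mx B -> B *m (B *m w) = chi *: w) -> chi = c.
Proof.
have PB : P \in im_mx B by apply/mem_im_mx; exists X.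
move=> /(_ P PB); rewrite wedge22_sqr // => /eqP.
by rewrite eq_sym -subr_eq0 -scalerBl scaler_eq0 (negPf P0) orbF subr_eq0 => /eqP.
Qed.

(** The converse implications need no case analysis: the scalar by which B^2
    acts on the image is unique, because P is a nonzero vector of the image. *)
Lemma wedge22_causal_type : [/\ c < 0 <-> elliptic_rotation B,
  0 < c <-> hyperbolic_boost B & c = 0 <-> parabolic_null_rotation B].
Proof.
split; split.
- exact: wedge22_elliptic.
- by case=> _ _ [chi chi0 /wedge22_eigenvalue <-].
- exact: wedge22_hyperbolic.
- by case=> _ _ [chi chi0 /wedge22_eigenvalue <-].
- exact: wedge22_parabolic.
- case=> B3 _; have : B ^+ 3 *m X = 0 by rewrite B3 mul0mx.
  rewrite wedge22_cube -scalemxAl BX => /eqP.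
  by rewrite scaler_eq0 (negPf P0) orbF => /eqP.
Qed.

End RotationGenerator.

End NeutralForm.

(** * Moving frames of cohomogeneity-one surfaces *)

Section MovingFrame.
Variable R : realType.
Implicit Types (a b d e u v : 'cV[R]_4).

Lemma has_deriv_in_ip22 D (f g : R -> 'cV[R]_4) x l m :
  has_deriv_in D f x l -> has_deriv_in D g x m ->
  has_deriv_in D (fun y => ip22 (f y) (g y)) x (ip22 l (g x) + ip22 (f x) m).
Proof.
move=> hf hg; rewrite /ip22 -big_split /=; apply: has_deriv_in_sum => i.
apply: has_deriv_inM; last exact: (has_deriv_in_entry (j := 0)).
by apply: has_deriv_in_scale; exact: (has_deriv_in_entry (j := 0)).
Qed.

(** A known Gram function of two fields gives a linear relation for the products
    of their derivatives; the structure equations are obtained only from such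
    relations. *)
Lemma ip22_product_rule D (f g : R -> 'cV[R]_4) h x l m h' :
  ProperFilter (within D (dnbhs x)) -> D x ->
  has_deriv_in D f x l -> has_deriv_in D g x m -> has_deriv_in D h x h' ->
  (forall y, D y -> ip22 (f y) (g y) = h y) ->
  ip22 l (g x) + ip22 (f x) m = h'.
Proof.
move=> PF Dx hf hg hh E; apply: has_deriv_in_unique hh.
exact: eq_has_deriv_in Dx E (has_deriv_in_ip22 hf hg).
Qed.

Lemma frame_ext4 a b d e u v :
  ip22 a b = 0 -> ip22 a d = 0 -> ip22 a e = 0 -> ip22 b d = 0 ->
  ip22 b e = 0 -> ip22 d e = 0 ->
  ip22 a a != 0 -> ip22 b b != 0 -> ip22 d d != 0 -> ip22 e e != 0 ->
  ip22 a u = ip22 a v -> ip22 b u = ip22 b v -> ip22 d u = ip22 d v ->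
  ip22 e u = ip22 e v -> u = v.
Proof.
move=> ab ad ae bd be de aa bb dd ee au bu du eu.
apply: (@orthogonal_frame_ext R (fun i => [:: a; b; d; e]`_i)).
- move=> [[|[|[|[|//]]]] hi] [[|[|[|[|//]]]] hj] //= _; rewrite // ip22C //.
- by move=> [[|[|[|[|//]]]] hi].
- by move=> [[|[|[|[|//]]]] hi].
Qed.

Variables (L : R) (I J : set R) (sigma eta eps : R) (rho rho' k1 k2 : R -> R).
Variables (X xi Xs Xt Xss Xst Xts Xtt : R -> R -> 'cV[R]_4).
Hypotheses (iI : is_interval I) (I0 : I° !=set0).
Hypotheses (iJ : is_interval J) (J0 : J° !=set0).
Hypotheses (L0 : 0 < L) (hsigma : sigma = -1 \/ sigma = 1).
Hypotheses (heta : eta = -1 \/ eta = 1) (heps : eps = - (sigma * eta)).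
Hypothesis rho0 : forall s, I s -> 0 < rho s.
Hypothesis rho_d : forall s, I s -> has_deriv_in I rho s (rho' s).
Hypothesis XX : forall s t, I s -> J t -> ip22 (X s t) (X s t) = - L ^+ 2.
Hypothesis g_ss : forall s t, I s -> J t -> ip22 (Xs s t) (Xs s t) = sigma.
Hypothesis g_st : forall s t, I s -> J t -> ip22 (Xs s t) (Xt s t) = 0.
Hypothesis g_tt : forall s t, I s -> J t -> ip22 (Xt s t) (Xt s t) = eta * rho s ^+ 2.
Hypothesis nX : forall s t, I s -> J t -> ip22 (xi s t) (X s t) = 0.
Hypothesis ns : forall s t, I s -> J t -> ip22 (xi s t) (Xs s t) = 0.
Hypothesis nt : forall s t, I s -> J t -> ip22 (xi s t) (Xt s t) = 0.
Hypothesis nn : forall s t, I s -> J t -> ip22 (xi s t) (xi s t) = eps.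
Hypothesis X_s : forall s t, I s -> J t -> has_deriv_in I (X^~ t) s (Xs s t).
Hypothesis X_t : forall s t, I s -> J t -> has_deriv_in J (X s) t (Xt s t).
Hypothesis X_ss : forall s t, I s -> J t -> has_deriv_in I (Xs^~ t) s (Xss s t).
Hypothesis X_st : forall s t, I s -> J t -> has_deriv_in J (Xs s) t (Xst s t).
Hypothesis X_ts : forall s t, I s -> J t -> has_deriv_in I (Xt^~ t) s (Xts s t).
Hypothesis X_tt : forall s t, I s -> J t -> has_deriv_in J (Xt s) t (Xtt s t).
Hypothesis xi_s : forall s t, I s -> J t ->
  has_deriv_in I (xi^~ t) s (- k1 s *: Xs s t).
Hypothesis xi_t : forall s t, I s -> J t ->
  has_deriv_in J (xi s) t (- k2 s *: Xt s t).
Hypothesis symX : forall s t, I s -> J t -> Xst s t = Xts s t.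

Lemma position_orthogonal s t : I s -> J t ->
  ip22 (X s t) (Xs s t) = 0 /\ ip22 (X s t) (Xt s t) = 0.
Proof.
move=> Is Jt.
have PI := interval_limit_point iI I0 Is; have PJ := interval_limit_point iJ J0 Jt.
have := ip22_product_rule PI Is (X_s Is Jt) (X_s Is Jt)
  (has_deriv_in_cst I (- L ^+ 2) s) (fun y Iy => XX Iy Jt).
have := ip22_product_rule PJ Jt (X_t Is Jt) (X_t Is Jt)
  (has_deriv_in_cst J (- L ^+ 2) t) (fun y Jy => XX Is Jy).
by rewrite /= !(ip22C _ (X s t)); lra.
Qed.

Lemma surface_frame_ext s t u v : I s -> J t ->
  ip22 (X s t) u = ip22 (X s t) v -> ip22 (Xs s t) u = ip22 (Xs s t) v ->
  ip22 (Xt s t) u = ip22 (Xt s t) v -> ip22 (xi s t) u = ip22 (xi s t) v -> u = v.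
Proof.
move=> Is Jt; have [Xa Xb] := position_orthogonal Is Jt.
have rp := rho0 Is.
have e2 : sigma != 0 /\ eta != 0.
  by case: hsigma heta => -> [] ->; rewrite ?oppr_eq0 oner_eq0.
apply: frame_ext4 => //;
  rewrite ?(ip22C _ (xi _ _)) ?nX ?ns ?nt ?nn ?g_st ?XX ?g_ss ?g_tt //.
- by rewrite oppr_eq0 expf_neq0 // gt_eqF.
- by case: e2.
- by rewrite mulf_neq0 ?expf_neq0 //; [case: e2|rewrite gt_eqF].
- by rewrite heps oppr_eq0 mulf_neq0 //; case: e2.
Qed.

(** The second derivatives are determined by their products with the frame,
    and these come from differentiating the Gram relations. The symmetry
    X_st = X_ts enters in the relations that mix the two directions; for
    instance it makes <X_st, X_t> half the s-derivative of <X_t, X_t>. *)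
Lemma structure_equations s t : I s -> J t ->
  [/\ Xst s t = (rho' s / rho s) *: Xt s t,
      Xss s t = (sigma / L ^+ 2) *: X s t + (eps * sigma * k1 s) *: xi s t &
      Xtt s t = (eta * rho s ^+ 2 / L ^+ 2) *: X s t
        - (sigma * eta * rho s * rho' s) *: Xs s t
        + (eps * eta * rho s ^+ 2 * k2 s) *: xi s t].
Proof.
move=> Is Jt; have [Xa Xb] := position_orthogonal Is Jt.
have PI := interval_limit_point iI I0 Is; have PJ := interval_limit_point iJ J0 Jt.
have cst0 D (r x : R) : has_deriv_in D (fun=> r) x 0 by exact: has_deriv_in_cst.
have Rn0 : rho s != 0 by rewrite gt_eqF // rho0.
have L2n0 : L != 0 by rewrite gt_eqF.
have E1 := ip22_product_rule PI Is (X_s Is Jt) (X_ss Is Jt) (cst0 _ 0 _)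
  (fun y Iy => (position_orthogonal Iy Jt).1).
have E2 := ip22_product_rule PI Is (X_ss Is Jt) (X_ss Is Jt) (cst0 _ sigma _)
  (fun y Iy => g_ss Iy Jt).
have E3 := ip22_product_rule PI Is (X_ss Is Jt) (X_ts Is Jt) (cst0 _ 0 _)
  (fun y Iy => g_st Iy Jt).
have E4 := ip22_product_rule PI Is (xi_s Is Jt) (X_ss Is Jt) (cst0 _ 0 _)
  (fun y Iy => ns Iy Jt).
have F1 := ip22_product_rule PJ Jt (X_t Is Jt) (X_st Is Jt) (cst0 _ 0 _)
  (fun y Jy => (position_orthogonal Is Jy).1).
have F2 := ip22_product_rule PJ Jt (X_st Is Jt) (X_st Is Jt) (cst0 _ sigma _)
  (fun y Jy => g_ss Is Jy).
have F4 := ip22_product_rule PJ Jt (xi_t Is Jt) (X_st Is Jt) (cst0 _ 0 _)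
  (fun y Jy => ns Is Jy).
have rho2_d : has_deriv_in I (fun y => eta * rho y ^+ 2) s
    (eta * (rho' s * rho s + rho s * rho' s)).
  exact: (has_deriv_in_scale (has_deriv_inM (rho_d Is) (rho_d Is))).
have F3 := ip22_product_rule PI Is (X_ts Is Jt) (X_ts Is Jt) rho2_d
  (fun y Iy => g_tt Iy Jt).
have G1 := ip22_product_rule PJ Jt (X_t Is Jt) (X_tt Is Jt) (cst0 _ 0 _)
  (fun y Jy => (position_orthogonal Is Jy).2).
have G2 := ip22_product_rule PJ Jt (X_st Is Jt) (X_tt Is Jt) (cst0 _ 0 _)
  (fun y Jy => g_st Is Jy).
have G3 := ip22_product_rule PJ Jt (X_tt Is Jt) (X_tt Is Jt) (cst0 _ _ _)
  (fun y Jy => g_tt Is Jy).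
have G4 := ip22_product_rule PJ Jt (xi_t Is Jt) (X_tt Is Jt) (cst0 _ 0 _)
  (fun y Jy => nt Is Jy).
have xx := XX Is Jt; have s2 := g_ss Is Jt; have st0 := g_st Is Jt.
have t2 := g_tt Is Jt; have nX0 := nX Is Jt; have ns0 := ns Is Jt.
have nt0 := nt Is Jt; have n2 := nn Is Jt; have sym := symX Is Jt.
rewrite /= -?sym in E1 E2 E3 E4 F1 F2 F3 F4 G1 G2 G3 G4.
rewrite !ip22_lin in E4 F4 G4.
have st0' := st0; rewrite ip22C in st0'.
have Xa' := Xa; rewrite ip22C in Xa'. have Xb' := Xb; rewrite ip22C in Xb'.
have nX' := nX0; rewrite ip22C in nX'. have ns' := ns0; rewrite ip22C in ns'.
have nt' := nt0; rewrite ip22C in nt'.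
rewrite ?(ip22C (Xss s t)) ?(ip22C (Xst s t)) ?(ip22C (Xtt s t))
  in E1 E2 E3 E4 F1 F2 F3 F4 G1 G2 G3 G4.
rewrite ?s2 ?t2 ?st0 ?st0' in E1 E2 E3 E4 F1 F2 F3 F4 G1 G2 G3 G4.
have Xst_X : ip22 (X s t) (Xst s t) = 0 by lra.
have Xst_s : ip22 (Xs s t) (Xst s t) = 0 by lra.
have Xst_t : ip22 (Xt s t) (Xst s t) = eta * rho s * rho' s by lra.
have Xst_n : ip22 (xi s t) (Xst s t) = 0 by lra.
have Xss_X : ip22 (X s t) (Xss s t) = - sigma by lra.
have Xss_s : ip22 (Xs s t) (Xss s t) = 0 by lra.
have Xss_t : ip22 (Xt s t) (Xss s t) = 0 by lra.
have Xss_n : ip22 (xi s t) (Xss s t) = sigma * k1 s by lra.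
have Xtt_X : ip22 (X s t) (Xtt s t) = - (eta * rho s ^+ 2) by lra.
have Xtt_s : ip22 (Xs s t) (Xtt s t) = - (eta * rho s * rho' s) by lra.
have Xtt_t : ip22 (Xt s t) (Xtt s t) = 0 by lra.
have Xtt_n : ip22 (xi s t) (Xtt s t) = eta * rho s ^+ 2 * k2 s by lra.
split; apply: (surface_frame_ext Is Jt);
  rewrite !ip22_lin ?(Xst_X, Xst_s, Xst_t, Xst_n, Xss_X, Xss_s, Xss_t, Xss_n,
    Xtt_X, Xtt_s, Xtt_t, Xtt_n, xx, s2, t2, n2, st0, st0', Xa, Xa', Xb, Xb',
    nX0, nX', ns0, ns', nt0, nt');
  case: hsigma => hs; case: heta => he; rewrite ?heps ?hs ?he;
  field; rewrite ?Rn0 ?L2n0 //.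
Qed.

Let q s := rho' s / rho s.

Hypothesis q_d : forall s, I s ->
  has_deriv_in I q s (sigma * ((L ^+ 2)^-1 - eps * k1 s * k2 s) - q s ^+ 2).
Hypothesis k2_d : forall s, I s -> has_deriv_in I k2 s (q s * (k1 s - k2 s)).

(** The vector that pairs with X_t in the bivector of the generator: its
    products with X, X_s and xi are the coefficients of X_t in the t-derivatives
    of these fields, namely 1, q and - k_2. *)
Definition axis s t : 'cV[R]_4 :=
  - (L ^+ 2)^-1 *: X s t + (sigma * q s) *: Xs s t + (- eps * k2 s) *: xi s t.

Lemma axis_products s t : I s -> J t ->
  [/\ ip22 (Xt s t) (axis s t) = 0, ip22 (axis s t) (X s t) = 1 &
      ip22 (axis s t) (axis s t) =
        - ((L ^+ 2)^-1 - sigma * q s ^+ 2 - eps * k2 s ^+ 2)].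
Proof.
move=> Is Jt; have [Xa Xb] := position_orthogonal Is Jt.
have L2n0 : L != 0 by rewrite gt_eqF.
rewrite /axis !ip22_lin ?XX ?g_ss ?nn ?nX ?ns // !(ip22C _ (xi s t)).
rewrite !(ip22C (Xt s t)) !(ip22C _ (X s t)) ?(ip22C (X s t) (xi s t)).
rewrite Xa Xb ?nX ?ns ?nt ?g_st //.
by split; case: hsigma => hs; case: heta => he; rewrite ?heps ?hs ?he; field.
Qed.

(** The Gauss equation turns the coefficient
    - 1 / L^2 + sigma q' + eps k_1 k_2 of X_s into - sigma q^2, and the Codazzi
    equation turns the coefficient eps (q k_1 - k_2') of xi into eps q k_2. *)
Lemma has_deriv_in_axis_s s t : I s -> J t ->
  has_deriv_in I (axis^~ t) s (- q s *: axis s t).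
Proof.
move=> Is Jt; have [_ E _] := structure_equations Is Jt.
have h := has_deriv_inD (has_deriv_inD
  (has_deriv_in_scale (a := - (L ^+ 2)^-1) (X_s Is Jt))
  (has_deriv_inZ (has_deriv_in_scale (a := sigma) (q_d Is)) (X_ss Is Jt)))
  (has_deriv_inZ (has_deriv_in_scale (a := - eps) (k2_d Is)) (xi_s Is Jt)).
have L2n0 : L != 0 by rewrite gt_eqF.
move: h; rewrite /= E; set l := (X in has_deriv_in _ _ _ X).
suff -> : l = - q s *: axis s t by [].
rewrite /l /axis /GRing.scale /=; apply/colP => i; rewrite !mxE.
by case: hsigma => hs; case: heta => he; rewrite ?heps ?hs ?he; field.
Qed.

Lemma has_deriv_in_axis_t s t : I s -> J t ->
  has_deriv_in J (axis s) t (ip22 (axis s t) (axis s t) *: Xt s t).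
Proof.
move=> Is Jt; have [E _ _] := structure_equations Is Jt.
have h := has_deriv_inD (has_deriv_inD
  (has_deriv_in_scale (a := - (L ^+ 2)^-1) (X_t Is Jt))
  (has_deriv_in_scale (a := sigma * q s) (X_st Is Jt)))
  (has_deriv_in_scale (a := - eps * k2 s) (xi_t Is Jt)).
move: h; rewrite /= E -/(q s); set l := (X in has_deriv_in _ _ _ X).
suff -> : l = ip22 (axis s t) (axis s t) *: Xt s t by [].
have [_ _ ->] := axis_products Is Jt.
by rewrite /l !scalerA -!scalerDl; congr (_ *: _); ring.
Qed.

Definition generator s t := wedge22 (Xt s t) (axis s t).

(** In s the factors X_t and [axis] scale with opposite rates q and - q; in t
    each derivative is a multiple of the other factor, so its wedge with that
    factor vanishes. *)
Lemma generator_cst s t s' t' : I s -> J t -> I s' -> J t' ->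
  generator s t = generator s' t'.
Proof.
move=> Is Jt Is' Jt'.
transitivity (generator s' t); apply: eq_mulmx_col => v.
  apply: (deriv_in_eq0_cst (f := fun s => generator s t *m v) iI) => // u Iu.
  have [E _ _] := structure_equations Iu Jt.
  have hP := X_ts Iu Jt; rewrite -symX // E -/(q u) in hP.
  have hZ := has_deriv_in_axis_s Iu Jt.
  have hv := has_deriv_in_cst I v u.
  have := has_deriv_inD (has_deriv_inZ (has_deriv_in_ip22 hZ hv) hP)
    (has_deriv_in_scale (a := -1) (has_deriv_inZ (has_deriv_in_ip22 hP hv) hZ)).
  rewrite (ip22C _ 0) ip220l (ip22C _ 0) ip220l.
  set l := (X in has_deriv_in _ _ _ X).
  have -> : l = 0.
    by rewrite /l !ip22_lin; apply/colP => i; rewrite !mxE; ring.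
  apply: eq_has_deriv_in => // y Iy.
  by rewrite /generator wedge22E scaleN1r.
apply: (deriv_in_eq0_cst (f := fun t => generator s' t *m v) iJ) => // u Ju.
have [_ _ E] := structure_equations Is' Ju.
have hP := X_tt Is' Ju.
have {}E : Xtt s' u = - ip22 (Xt s' u) (Xt s' u) *: axis s' u.
  have Rn0 : rho s' != 0 by rewrite gt_eqF // rho0.
  have L2n0 : L != 0 by rewrite gt_eqF.
  rewrite E g_tt // /axis /q; apply/colP => i; rewrite !mxE.
  by field; rewrite Rn0 L2n0.
rewrite E in hP.
have hZ := has_deriv_in_axis_t Is' Ju.
have hv := has_deriv_in_cst J v u.
have := has_deriv_inD (has_deriv_inZ (has_deriv_in_ip22 hZ hv) hP)
  (has_deriv_in_scale (a := -1) (has_deriv_inZ (has_deriv_in_ip22 hP hv) hZ)).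
rewrite (ip22C _ 0) ip220l (ip22C _ 0) ip220l.
set l := (X in has_deriv_in _ _ _ X).
have -> : l = 0.
  by rewrite /l !ip22_lin; apply/colP => i; rewrite !mxE; ring.
apply: eq_has_deriv_in => // y Iy.
by rewrite /generator wedge22E scaleN1r.
Qed.

(** Since B is constant and nonzero, B^3 = c(s) B at every s makes c(s)
    independent of s. *)
Lemma rotational_generator_normal_form : J 0 ->
  exists c0, (forall s, I s -> eta * rho s ^+ 2 *
      ((L ^+ 2)^-1 - sigma * q s ^+ 2 - eps * k2 s ^+ 2) = c0) /\
    exists B : 'M[R]_4,
      [/\ so22 B,
          forall s t, I s -> J t -> Xt s t = B *m X s t,
          forall s t, I s -> J t -> X s t = expmx (t *: B) *m X s 0,
          B ^+ 3 = c0 *: B &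
          (\rank B = 2)%N /\
          [/\ c0 < 0 <-> elliptic_rotation B,
              0 < c0 <-> hyperbolic_boost B &
              c0 = 0 <-> parabolic_null_rotation B]].
Proof.
move=> J00; have [s0 /interior_subset Is0] := I0.
have cE s : I s -> eta * rho s ^+ 2 *
    ((L ^+ 2)^-1 - sigma * q s ^+ 2 - eps * k2 s ^+ 2) =
    - (ip22 (Xt s 0) (Xt s 0) * ip22 (axis s 0) (axis s 0)).
  by move=> Is; have [_ _ ->] := axis_products Is J00; rewrite g_tt // mulrN opprK.
have norm s t : I s -> J t -> [/\ ip22 (Xt s t) (Xt s t) != 0,
    ip22 (Xt s t) (axis s t) = 0, ip22 (axis s t) (X s t) = 1 &
    ip22 (Xt s t) (X s t) = 0].
  move=> Is Jt; have [PZ ZX _] := axis_products Is Jt; split => //.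
    rewrite g_tt // mulf_neq0 //; last by rewrite expf_neq0 // gt_eqF ?rho0.
    by case: heta => ->; rewrite ?oppr_eq0 oner_eq0.
  by rewrite ip22C; case: (position_orthogonal Is Jt).
pose B := generator s0 0.
have BE s t : I s -> J t -> B = wedge22 (Xt s t) (axis s t).
  by move=> Is Jt; exact: generator_cst.
have XtB s t : I s -> J t -> Xt s t = B *m X s t.
  move=> Is Jt; have [_ _ ZX PX] := norm s t Is Jt.
  by rewrite (BE s t) // wedge22E ZX PX scale1r scale0r subr0.
exists (eta * rho s0 ^+ 2 * ((L ^+ 2)^-1 - sigma * q s0 ^+ 2 - eps * k2 s0 ^+ 2)).
have B3 s : I s -> B ^+ 3 = (eta * rho s ^+ 2 *
    ((L ^+ 2)^-1 - sigma * q s ^+ 2 - eps * k2 s ^+ 2)) *: B.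
  move=> Is; have [_ PZ _ _] := norm s 0 Is J00.
  by rewrite cE // (BE s 0) //; exact: wedge22_cube.
have [PP PZ ZX PX] := norm s0 0 Is0 J00.
have rankB : \rank B = 2%N := mxrank_wedge22 PP PZ ZX PX.
split=> [s Is|].
  have /eqP := B3 s Is; rewrite (B3 s0 Is0) -subr_eq0 -scalerBl scaler_eq0 subr_eq0.
  by case/orP => [/eqP -> //|/eqP B0]; move: rankB; rewrite B0 mxrank0.
exists B; split => //.
- exact: wedge22_so22.
- move=> s t Is Jt; apply: (linear_ode_expmx (y := X s) iJ J00) Jt => u Ju.
  by rewrite -XtB //; exact: X_t.
- exact: B3.
- by split=> //; rewrite cE //; exact: (wedge22_causal_type PP PZ ZX PX).
Qed.

End MovingFrame.

Lemma within_continuous_entry (R : realType) (T : topologicalType) (D : set T)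
    m n (f : T -> 'M[R]_(m.+1, n.+1)) i j :
  {within D, continuous f} -> {within D, continuous (fun x => f x i j)}.
Proof.
move=> cf x; exact: cvg_comp (cf x) (@coord_continuous _ _ _ i j (f x)).
Qed.

Theorem theorem5p2 (R : realType) (L : R) (I J : set R)
    (X xi : R -> R -> 'cV[R]_4) (A : R -> R -> 'M[R]_2)
    (sigma eta eps : R) (rho k1 k2 : R -> R) :
  let e1 : 'cV[R]_2 := delta_mx 0 0 in
  let e2 : R -> 'cV[R]_2 := fun s => (rho s)^-1 *: delta_mx 1 0 in
  let q : R -> R := fun s => deriv_in I rho s / rho s in
  let c : R -> R := fun s =>
    eta * rho s ^+ 2 *
      ((L ^+ 2)^-1 - sigma * q s ^+ 2 - eps * k2 s ^+ 2) in
  0 < L ->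
  is_interval I -> I° !=set0 ->
  is_interval J -> J° !=set0 -> J 0 ->
  smooth_in2 I J X -> smooth_in2 I J xi ->
  smooth_in I rho -> smooth_in I k1 -> smooth_in I k2 ->
  sigma = -1 \/ sigma = 1 ->
  eta = -1 \/ eta = 1 ->
  eps = - (sigma * eta) ->
  (forall s, I s -> 0 < rho s) ->
  (forall s t, I s -> J t -> AdS3 L (X s t)) ->
  (forall s t, I s -> J t -> forall Y Z,
     induced_metric I J X s t Y Z =
       sigma * (Y 0 0 * Z 0 0) + eta * rho s ^+ 2 * (Y 1 0 * Z 1 0)) ->
  unit_normal_field I J X eps xi ->
  shape_operator L I J X xi A ->
  (forall s t, I s -> J t -> A s t *m e1 = k1 s *: e1) ->
  (forall s t, I s -> J t -> A s t *m e2 s = k2 s *: e2 s) ->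
  (forall s, I s ->
     deriv_in I q s = sigma * ((L ^+ 2)^-1 - eps * k1 s * k2 s) - q s ^+ 2) ->
  (forall s, I s -> deriv_in I k2 s = q s * (k1 s - k2 s)) ->
  exists c0 : R, (forall s, I s -> c s = c0) /\
    exists B : 'M[R]_4,
      [/\ so22 B,
          forall s t, I s -> J t -> partial_t J X s t = B *m X s t,
          forall s t, I s -> J t -> X s t = expmx (t *: B) *m X s 0,
          B ^+ 3 = c0 *: B &
          (\rank B = 2)%N /\
          [/\ c0 < 0 <-> elliptic_rotation B,
              0 < c0 <-> hyperbolic_boost B &
              c0 = 0 <-> parabolic_null_rotation B]].
Proof.
move=> e1 e2 q c L0 iI I0 iJ J0 J00 smX smxi smrho _ smk2 hsigma heta heps rho0.
move=> XAdS metric normal shape Ae1 Ae2 gauss codazzi.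
have d1E s t (f : R -> R -> 'cV[R]_4) : diff_in2 I J f s t e1 = partial_s I f s t.
  by rewrite /diff_in2 !mxE /= scale1r scale0r addr0.
have d2E s t (f : R -> R -> 'cV[R]_4) :
    diff_in2 I J f s t (delta_mx 1 0) = partial_t J f s t.
  by rewrite /diff_in2 !mxE /= scale1r scale0r add0r.
have [_ [X_d [_ [Xs_d _ [Xst_c _]]] [_ [Xt_d [Xts_c _] _]]]] := smX 2.
have [_ [xi_d _ _]] := smxi 1.
have [_ [rho_d [_ [rho_dd _]]]] := smrho 2.
have [_ [k2_d _]] := smk2 1.
have gss s t : I s -> J t -> ip22 (partial_s I X s t) (partial_s I X s t) = sigma.
  move=> Is Jt; have := metric s t Is Jt e1 e1.
  by rewrite /induced_metric d1E !mxE /= => ->; ring.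
have gst s t : I s -> J t -> ip22 (partial_s I X s t) (partial_t J X s t) = 0.
  move=> Is Jt; have := metric s t Is Jt e1 (delta_mx 1 0).
  by rewrite /induced_metric d1E d2E !mxE /= => ->; ring.
have gtt s t : I s -> J t ->
    ip22 (partial_t J X s t) (partial_t J X s t) = eta * rho s ^+ 2.
  move=> Is Jt; have := metric s t Is Jt (delta_mx 1 0) (delta_mx 1 0).
  by rewrite /induced_metric d2E !mxE /= => ->; ring.
have nX s t : I s -> J t -> ip22 (xi s t) (X s t) = 0.
  by move=> Is Jt; case: (normal s t Is Jt).
have ns s t : I s -> J t -> ip22 (xi s t) (partial_s I X s t) = 0.
  by move=> Is Jt; case: (normal s t Is Jt) => _ /(_ e1); rewrite d1E.
have nt s t : I s -> J t -> ip22 (xi s t) (partial_t J X s t) = 0.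
  by move=> Is Jt; case: (normal s t Is Jt) => _ /(_ (delta_mx 1 0)); rewrite d2E.
have nn s t : I s -> J t -> ip22 (xi s t) (xi s t) = eps.
  by move=> Is Jt; case: (normal s t Is Jt).
have xi_s s t : I s -> J t ->
    has_deriv_in I (xi^~ t) s (- k1 s *: partial_s I X s t).
  move=> Is Jt; have h := derivable_inP (xi_d s t Is Jt).1.
  have PI := interval_limit_point iI I0 Is.
  have := ip22_product_rule PI Is h (derivable_inP (X_d s t Is Jt).1)
    (has_deriv_in_cst I (0 : R) s) (fun y Iy => nX y t Iy Jt).
  rewrite -/(partial_s I X s t) ns // addr0 => tangent.
  have := shape s t Is Jt e1.
  rewrite /nablaN d1E /partial_s tangent mul0r scale0r addr0 Ae1 // => E.
  suff -> : - k1 s *: partial_s I X s t = deriv_in I (xi^~ t) s by [].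
  by rewrite E /diff_in2 !mxE /= mulr0 mulr1 scale0r addr0 scaleNr.
have xi_t s t : I s -> J t ->
    has_deriv_in J (xi s) t (- k2 s *: partial_t J X s t).
  move=> Is Jt; have h := derivable_inP (xi_d s t Is Jt).2.
  have PJ := interval_limit_point iJ J0 Jt.
  have := ip22_product_rule PJ Jt h (derivable_inP (X_d s t Is Jt).2)
    (has_deriv_in_cst J (0 : R) t) (fun y Jy => nX s y Is Jy).
  rewrite -/(partial_t J X s t) nt // addr0 => tangent.
  have A2 : A s t *m delta_mx 1 0 = k2 s *: delta_mx 1 0 :> 'cV[R]_2.
    have := congr1 (fun v => rho s *: v) (Ae2 s t Is Jt).
    by rewrite /e2 -scalemxAr !scalerA mulrAC mulfV ?gt_eqF ?rho0 // mul1r scale1r.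
  have := shape s t Is Jt (delta_mx 1 0).
  rewrite /nablaN d2E /partial_t tangent mul0r scale0r addr0 A2 // => E.
  suff -> : - k2 s *: partial_t J X s t = deriv_in J (xi s) t by [].
  by rewrite E /diff_in2 !mxE /= mulr0 mulr1 scale0r add0r scaleNr.
have sym s t : I s -> J t ->
    partial_t J (partial_s I X) s t = partial_s I (partial_t J X) s t.
  move=> Is Jt; apply/colP => i.
  apply: (@schwarz_in R I J (fun s t => X s t i 0)
    (fun s t => partial_s I X s t i 0) (fun s t => partial_t J X s t i 0)
    (fun s t => partial_t J (partial_s I X) s t i 0)
    (fun s t => partial_s I (partial_t J X) s t i 0)) => //.
  - move=> u v Iu Jv; apply: (has_deriv_in_entry (j := 0)).
    exact: derivable_inP (X_d u v Iu Jv).1.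
  - move=> u v Iu Jv; apply: (has_deriv_in_entry (j := 0)).
    exact: derivable_inP (X_d u v Iu Jv).2.
  - move=> u v Iu Jv; apply: (has_deriv_in_entry (j := 0)).
    exact: derivable_inP (Xs_d u v Iu Jv).2.
  - move=> u v Iu Jv; apply: (has_deriv_in_entry (j := 0)).
    exact: derivable_inP (Xt_d u v Iu Jv).1.
  - exact: within_continuous_entry Xst_c.
  - exact: within_continuous_entry Xts_c.
have q_d s : I s ->
    has_deriv_in I q s (sigma * ((L ^+ 2)^-1 - eps * k1 s * k2 s) - q s ^+ 2).
  move=> Is; rewrite -gauss //; apply: derivable_inP.
  apply/cvg_ex; eexists.
  apply: has_deriv_inM; first exact: derivable_inP (rho_dd s Is).
  apply: has_deriv_inV; last exact: derivable_inP (rho_d s Is).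
  by rewrite gt_eqF ?rho0.
have k2_d' s : I s -> has_deriv_in I k2 s (q s * (k1 s - k2 s)).
  by move=> Is; rewrite -codazzi //; exact: derivable_inP (k2_d s Is).
apply: (rotational_generator_normal_form (rho' := deriv_in I rho)
  (Xs := partial_s I X) (Xss := partial_s I (partial_s I X))
  (Xst := partial_t J (partial_s I X)) (Xts := partial_s I (partial_t J X))
  (Xtt := partial_t J (partial_t J X)) iI I0 iJ J0 L0 hsigma heta heps rho0
  _ _ gss gst gtt nX ns nt nn _ _ _ _ _ _ xi_s xi_t sym q_d k2_d' J00).
- by move=> s Is; exact: derivable_inP (rho_d s Is).
- by move=> s t Is Jt; exact: XAdS.
- by move=> s t Is Jt; exact: derivable_inP (X_d s t Is Jt).1.
- by move=> s t Is Jt; exact: derivable_inP (X_d s t Is Jt).2.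
- by move=> s t Is Jt; exact: derivable_inP (Xs_d s t Is Jt).1.
- by move=> s t Is Jt; exact: derivable_inP (Xs_d s t Is Jt).2.
- by move=> s t Is Jt; exact: derivable_inP (Xt_d s t Is Jt).1.
- by move=> s t Is Jt; exact: derivable_inP (Xt_d s t Is Jt).2.
Qed.
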